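(* Let $n\ge3$, $\ell\ge2$, and let $\lambda=[d_1,\ldots,d_r]$ be a partition of $d$ with $r\ge2$ parts. If $\sigma_\ell(\mathbb X_{n-1,\lambda})$ is not defective and does not overly fill its ambient space, then the secant variety $\sigma_\ell(X_{n-1,\lambda})$ of the Segre variety $X_{n-1,\lambda}$ is not defective.
   Context: Let $\mathbb K$ be an algebraically closed field of characteristic zero and $S=\mathbb K[x_1,\ldots,x_n]=\bigoplus_{i\ge0}[S]_i$ the standard graded polynomial ring. A partition $\lambda=[d_1,\ldots,d_r]$ of $d$ consists of integers $d_1\ge\cdots\ge d_r\ge1$ with sum $d$. The variety of $\lambda$-reducible forms is $$\mathbb X_{n-1,\lambda}=\{[F]\in\mathbb P([S]_d)=\mathbb P^{\binom{d+n-1}{n-1}-1}\mid F=F_1\cdots F_r,\ 0\ne F_i\in[S]_{d_i}\}.$$ $X_{n-1,\lambda}$ (non-blackboard $X$) denotes the Segre embedding of $\mathbb P^{n_1-1}\times\cdots\times\mathbb P^{n_r-1}$ in $\mathbb P^{n_1n_2\cdots n_r-1}$, where $n_i=\binom{d_i+n-1}{n-1}$. For a variety $Y\subset\mathbb P^m$, $\sigma_\ell(Y)$ is the Zariski closure of the union of the linear spans of all subsets of $\ell$ distinct points of $Y$ (and $\mathbb P^m$ if $\ell\ge m+1$). Its expected dimension is $\min\{m,\ \ell\cdot\dim Y+\ell-1\}$, and $\sigma_\ell(Y)$ is defective if its dimension is strictly less than its expected dimension. When $\sigma_\ell(\mathbb X_{n-1,\lambda})$ is not defective, it is said to not overly fill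 its ambient space if $\dim\sigma_\ell(\mathbb X_{n-1,\lambda})=\ell\cdot\dim\mathbb X_{n-1,\lambda}+\ell-1$. *)

(* Defs.v *)
From mathcomp Require Import all_boot all_order all_algebra.
From mathcomp Require Import boolp classical_sets.
From mathcomp Require Import mpoly.

Set Implicit Arguments.
Unset Strict Implicit.
Unset Printing Implicit Defensive.

Import GRing.Theory.

Local Open Scope classical_set_scope.
Local Open Scope ring_scope.

Section ProjectiveSpace.
Variables (K : closedFieldType) (V : vectType K).

(* P(V), the points being the lines through the origin of V. *)
Definition proj := {L : {vspace V} | \dim L == 1%N}.

(* P(V) = P^m with m + 1 = dim V. *)
Definition pdim : nat := (\dim {:V}).-1.

(* Homogeneous coordinates, in the basis of V chosen by the library; zclosed
   below does not depend on this choice. *)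
Definition coords (v : V) : 'I_(\dim {:V}) -> K :=
  fun i => coord (vbasis {:V}) i v.

Definition zero_locus (I : set {mpoly K[\dim {:V}]}) : set proj :=
  [set L : proj | forall p, I p -> forall v, v \in val L -> p.@[coords v] = 0].

Definition zclosed (C : set proj) : Prop :=
  exists I : set {mpoly K[\dim {:V}]},
    (forall p, I p -> exists e : nat, p \is e.-homog) /\ C = zero_locus I.

Definition zclosure (Y : set proj) : set proj := smallest zclosed Y.

(* Irreducibility for the induced Zariski topology. *)
Definition zirreducible (Z : set proj) : Prop :=
  Z !=set0 /\ forall A B : set proj, zclosed A -> zclosed B ->
    Z `<=` A `|` B -> Z `<=` A \/ Z `<=` B.

(* Z_0 < Z_1 < ... < Z_k, irreducible and relatively closed subsets of Y. *)
Definition zchain (Y : set proj) (k : nat) : Prop :=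
  exists Z : nat -> set proj,
    (forall i, (i <= k)%N -> zirreducible (Z i) /\
        exists2 C, zclosed C & Z i = Y `&` C) /\
    (forall i, (i < k)%N -> Z i `<` Z i.+1).

(* Krull dimension: the largest length of such a chain.  Every nonempty subset
   of P(V) has one; the default value 0 is only relevant for the empty set. *)
Definition is_zdim (Y : set proj) (k : nat) : Prop :=
  zchain Y k /\ forall j, zchain Y j -> (j <= k)%N.

Definition zdim (Y : set proj) : nat := xget 0%N [set k | is_zdim Y k].

Definition secant_span (l : nat) (Y : set proj) : set proj :=
  [set L : proj | exists P : 'I_l -> proj,
     [/\ injective P, forall i, Y (P i) &
         (val L <= \sum_(i < l) val (P i))%VS]].

Definition secant (l : nat) (Y : set proj) : set proj :=
  if (pdim.+1 <= l)%N then setT else zclosure (secant_span l Y).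

Definition naive_secant_dim (l : nat) (Y : set proj) : nat :=
  (l * zdim Y + l - 1)%N.

Definition defective (l : nat) (Y : set proj) : Prop :=
  (zdim (secant l Y) < minn pdim (naive_secant_dim l Y))%N.

(* "sigma_l(Y) does not overly fill its ambient space", a notion meant for a
   nondefective sigma_l(Y). *)
Definition not_overly_filling (l : nat) (Y : set proj) : Prop :=
  zdim (secant l Y) = naive_secant_dim l Y.

End ProjectiveSpace.

Arguments proj {K} V.

Definition is_partition (d r : nat) (lam : r.-tuple nat) : Prop :=
  [/\ sorted geq lam, forall i, (1 <= tnth lam i)%N & sumn lam = d].

(* The variety of lam-reducible forms in k + 1 variables, inside P([S]_d);
   dhomog k.+1 K d is the space [S]_d of forms of degree d. *)
Definition reducible_forms (K : closedFieldType) (k d r : nat)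
    (lam : r.-tuple nat) : set (proj (dhomog k.+1 K d)) :=
  [set L | exists F : dhomog k.+1 K d, exists G : 'I_r -> {mpoly K[k.+1]},
     [/\ forall i, G i != 0, forall i, G i \is (tnth lam i).-homog,
         (F : {mpoly K[k.+1]}) = \prod_(i < r) G i & val L = <[F]>%VS]].

(* The Segre embedding of the product of the P^(N i - 1); the homogeneous
   coordinates of the ambient space are indexed by the tuples (j_i), where
   j_i < N i, so that there are prod_i N i of them. *)
Definition segre_index (r : nat) (N : 'I_r -> nat) : finType :=
  {dffun forall i : 'I_r, 'I_(N i)}.

Definition segre_space (K : closedFieldType) (r : nat) (N : 'I_r -> nat)
    : vectType K := {ffun segre_index N -> K^o}.

Definition segre (K : closedFieldType) (r : nat) (N : 'I_r -> nat) :
    set (proj (segre_space K N)) :=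
  [set L | exists u : forall i : 'I_r, 'rV[K]_(N i),
     (forall i, u i != 0) /\
     val L = <[([ffun j : segre_index N => \prod_(i < r) u i ord0 (j i)]
                 : segre_space K N)]>%VS].

(* X_{k,lam}, with N i = dim [S]_(lam i) for S in k + 1 variables. *)
Definition segre_of_partition (K : closedFieldType) (k r : nat)
    (lam : r.-tuple nat) :=
  @segre K r (fun i : 'I_r => 'C((tnth lam i + k)%N, k)).

Arguments reducible_forms K k d {r} lam.
Arguments segre K {r} N.
Arguments segre_of_partition K k {r} lam.

(* Main.v *)
From HB Require Import structures.
Require Import Defs.
From mathcomp Require Import all_boot all_order all_algebra.
From mathcomp Require Import boolp classical_sets.
From mathcomp Require Import perm mpoly.

Set Implicit Arguments.
Unset Strict Implicit.
Unset Printing Implicit Defensive.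

Import GRing.Theory.

Local Open Scope classical_set_scope.
Local Open Scope ring_scope.

(** The multiplication map sends a decomposable tensor u_1 (x) ... (x) u_r to
    the product of the forms with coordinate vectors u_i.  It is a linear map
    phi from the ambient space of the Segre variety X to [S]_d, it maps X onto
    the variety XX of reducible forms, and no point of X lies in its kernel,
    because a product of nonzero polynomials is nonzero.  Two things follow.

    - dim X <= dim XX: a linear projection whose centre misses a closed set is
      finite on it ([pimage_finite], [zdim_pimage_finite]).
    - dim sigma_l(XX) <= dim sigma_l(X): distinct points of XX lift to distinct
      points of X, so every point in the span of l points of XX is the image of
      a point in the span of l points of X, and a dominant rational map cannot
      raise the dimension ([secant_span_pimage], [zdim_hilb_ge]).

    Hence, if dim sigma_l(XX) = l dim XX + l - 1, then
    dim sigma_l(X) >= l dim X + l - 1 and X has no l-defect.  When either secant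
    variety is the whole space by convention, [zdimT] gives its dimension; for
    sigma_l(XX) that case is excluded because dim XX >= dim X > 0.

    The Krull dimension in the statement counts chains of irreducible closed
    sets, which behave badly under rational maps.  The link to algebra is the
    Hilbert function: the number of forms of degree e which are linearly
    independent on Y.  It can only grow when Y is replaced by a set mapping onto
    Y, since forms pull back.  The comparison has two halves.

    - A chain of length k forces growth of order e ^ k ([zchain_grows]): a form
      vanishing on Z but not on an irreducible Z' containing Z is a nonzero
      divisor on Z', so h_Z'(e) >= h_Z(e) + h_Z'(e - a).
    - A nonempty closed Y has, for some k, a chain of length k and a Hilbert
      function bounded by c (e + 1) ^ k ([closed_dimension]).  As long as Y is
      not the whole space, one projects it from a point p outside Y.  A form
      vanishing on Y but not at p gives a monic equation for the height over
      the image ([monic_equation]); consequently the image is closed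
      ([pimage_prj_closed]), the fibres are finite ([prj_fibre_finite]), h_Y is
      at most a constant times the Hilbert function of the image
      ([hilb_le_prj]), and chains lift from the image to Y ([lift_chain]).  The
      process stops at a full projective space, where flags of linear subspaces
      give the chain. *)

(** * Homogeneous polynomial functions and closed sets *)

Section Forms.
Variable K : closedFieldType.

(** Forms as functions on V, generated by linear forms: this makes pulling back
    along linear maps and expanding along a line immediate inductions, and
    avoids any choice of coordinates.  [hform_mpoly] is the link to
    polynomials. *)
Inductive hform (V : vectType K) : nat -> (V -> K) -> Prop :=
| hform_const c : hform 0 (fun=> c)
| hform_lin e (l : 'Hom(V, K^o)) f : hform e f -> hform e.+1 (fun v => l v * f v)
| hform_add e f g : hform e f -> hform e g -> hform e (fun v => f v + g v).

Lemma hform_ext (V : vectType K) e (f g : V -> K) : hform e f -> f =1 g -> hform e g.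
Proof. by move=> h /funext <-. Qed.

Lemma hform_zero (V : vectType K) e : hform e (fun _ : V => 0 : K).
Proof.
elim: e => [|e IH]; first exact: hform_const.
by apply: hform_ext (hform_lin 0 IH) _ => v; rewrite mulr0.
Qed.

Lemma hform_scale (V : vectType K) e (f : V -> K) c : hform e f -> hform e (fun v => c * f v).
Proof.
elim=> [b|a l g _ IH|a g h _ IHg _ IHh]; first exact: hform_const.
- by apply: hform_ext (hform_lin l IH) _ => v; rewrite mulrCA.
- by apply: hform_ext (hform_add IHg IHh) _ => v; rewrite mulrDr.
Qed.

Lemma hform_mul (V : vectType K) a b (f g : V -> K) :
  hform a f -> hform b g -> hform (a + b) (fun v => f v * g v).
Proof.
move=> + Hg; elim=> [c|e l h _ IH|e h k _ IHh _ IHk]; first exact: hform_scale.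
- by apply: hform_ext (hform_lin l IH) _ => v; rewrite mulrA.
- by apply: hform_ext (hform_add IHh IHk) _ => v; rewrite mulrDl.
Qed.

Lemma hform_sum (V : vectType K) e (I : Type) (r : seq I) (P : pred I) (F : I -> V -> K) :
  (forall i, P i -> hform e (F i)) -> hform e (fun v => \sum_(i <- r | P i) F i v).
Proof.
move=> HF; elim: r => [|i r IH].
  by apply: hform_ext (hform_zero V e) _ => v; rewrite big_nil.
case: (boolP (P i)) => Pi.
  by apply: hform_ext (hform_add (HF i Pi) IH) _ => v; rewrite big_cons Pi.
by apply: hform_ext IH _ => v; rewrite big_cons (negbTE Pi).
Qed.

Lemma hform_prod (V : vectType K) (I : Type) (r : seq I) (F : I -> V -> K) (d : I -> nat) :
  (forall i, hform (d i) (F i)) ->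
  hform (\sum_(i <- r) d i) (fun v => \prod_(i <- r) F i v).
Proof.
move=> HF; elim: r => [|i r IH].
  by rewrite big_nil; apply: hform_ext (hform_const _ 1) _ => v; rewrite big_nil.
rewrite big_cons; apply: hform_ext (hform_mul (HF i) IH) _ => v.
by rewrite big_cons.
Qed.

Lemma hform_exp (V : vectType K) a (f : V -> K) n : hform a f -> hform (a * n) (fun v => f v ^+ n).
Proof.
move=> Hf; elim: n => [|n IH].
  by rewrite muln0; apply: hform_ext (hform_const _ 1) _ => v; rewrite expr0.
by rewrite mulnS; apply: hform_ext (hform_mul Hf IH) _ => v; rewrite exprS.
Qed.

Lemma hform_linear (V : vectType K) (l : 'Hom(V, K^o)) : hform 1 (fun v => l v).
Proof. by apply: hform_ext (hform_lin l (hform_const _ 1)) _ => v; rewrite mulr1. Qed.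

Lemma hform_comp (V W : vectType K) (phi : 'Hom(V, W)) e f :
  hform e f -> hform e (fun v => f (phi v)).
Proof.
elim=> [c|a l g _ IH|a g h _ IHg _ IHh]; first exact: hform_const.
- by apply: hform_ext (hform_lin (l \o phi)%VF IH) _ => v; rewrite comp_lfunE.
- exact: hform_add IHg IHh.
Qed.

Lemma hform_homog (V : vectType K) e (f : V -> K) c v : hform e f -> f (c *: v) = c ^+ e * f v.
Proof.
elim=> [b|a l g _ IH|a g h _ IHg _ IHh]; first by rewrite expr0 mul1r.
- by rewrite IH linearZ /= /GRing.scale /= exprS mulrACA.
- by rewrite IHg IHh mulrDr.
Qed.

Lemma hform_deg0 (V : vectType K) (f : V -> K) : hform 0 f -> forall v w, f v = f w.
Proof.
move Ee: 0%N => e Hf; elim: Hf Ee => //= a g h _ IHg _ IHh /[dup] /IHg H1 /IHh H2 v w.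
by rewrite (H1 v w) (H2 v w).
Qed.

Definition coordl (V : vectType K) (i : 'I_(\dim {:V})) : 'Hom(V, K^o) :=
  linfun (coord (vbasis {:V}) i : V -> K^o).

Lemma coordlE (V : vectType K) i (v : V) : coordl i v = coords v i.
Proof. by rewrite lfunE. Qed.

Lemma coordlP (V : vectType K) (v : V) : v != 0 -> exists i, @coordl V i v != 0.
Proof.
move=> v0; apply: contrapT => /forallNP H; case/eqP: v0.
rewrite (coord_vbasis (memvf v)) big1 // => i _.
have /negP := H i; rewrite negbK coordlE => /eqP.
by rewrite /coords => ->; rewrite scale0r.
Qed.

(** A homogeneous polynomial is a combination of monomials, and each variable
    becomes a coordinate function. *)
Lemma hform_mpoly (V : vectType K) e (f : V -> K) :
  hform e f <-> exists2 p : {mpoly K[\dim {:V}]}, p \is e.-homog & f = fun v => p.@[coords v].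
Proof.
split.
- elim=> [c|a l g _ [p Hp ->]|a g h _ [p Hp ->] _ [q Hq ->]].
  + exists c%:MP; last by apply/funext => v; rewrite mevalC.
    by rewrite -[c%:MP]mulr1 mul_mpolyC rpredZ ?dhomog1.
  + exists ((\sum_(i < \dim {:V}) l (vbasis {:V})`_i *: 'X_i) * p).
      rewrite -addn1 addnC; apply: dhomogM => //; apply: rpred_sum => i _; apply: rpredZ.
      by rewrite dhomogX /= mdeg1.
    apply/funext => v; rewrite mevalM; congr (_ * _).
    rewrite {1}(coord_vbasis (memvf v)) linear_sum raddf_sum /=.
    apply: eq_bigr => i _; rewrite linearZ /= mevalZ mevalXU.
    by rewrite /GRing.scale /= mulrC.
  + by exists (p + q); [apply: rpredD | apply/funext => v; rewrite mevalD].
- case=> p Hp ->; rewrite {1}[p]mpolyE.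
  have -> : (fun v : V => (\sum_(m <- msupp p) p@_m *: 'X_[m]).@[coords v]) =
      fun v => \sum_(m <- msupp p | mdeg m == e) p@_m * \prod_i coordl i v ^+ m i.
    apply/funext => v; rewrite raddf_sum /= [RHS]big_mkcond /=.
    rewrite !big_seq; apply: eq_bigr => m mp; rewrite (dhomog_mf Hp mp) eqxx.
    by rewrite mevalZ mevalX; congr (_ * _); apply: eq_bigr => i _; rewrite coordlE.
  apply: hform_sum => m /eqP me; apply: hform_scale.
  suff -> : e = (\sum_i 1 * m i)%N.
    by apply: hform_prod => i; apply/hform_exp/hform_linear.
  by rewrite -me mdegE; apply: eq_bigr => i _; rewrite mul1n.
Qed.

Section Points.
Variable V : vectType K.
Implicit Types (L : proj V) (Y Z : set (proj V)) (v : V).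

Definition vanish (f : V -> K) L := forall v, v \in val L -> f v = 0.

(** Vectors rather than points are convenient for evaluating forms; the cone
    contains 0 as soon as Y has a point. *)
Definition cone Y v := exists2 L, Y L & v \in val L.

Lemma projP L : exists2 v, v != 0 & val L = <[v]>%VS.
Proof.
case: L => U /= dU.
have /eqP U0 : U != 0%VS by apply: contraTneq dU => ->; rewrite dimv0.
exists (vpick U); first by rewrite vpick0; apply/eqP.
apply/esym/eqP; rewrite eqEdim (eqP dU) dim_vline vpick0 -memvE memv_pick /=.
by move/eqP: U0 => ->.
Qed.

Lemma dim_pt v : v != 0 -> \dim <[v]> == 1%N.
Proof. by move=> v0; rewrite dim_vline v0. Qed.

Definition pt v (v0 : v != 0) : proj V := Sub <[v]>%VS (dim_pt v0).

Lemma projEpt L v (v0 : v != 0) : v \in val L -> L = pt v0.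
Proof.
move=> vL; apply/val_inj => /=; apply/esym/eqP.
by rewrite eqEdim -memvE vL (eqP (valP L)) dim_vline v0.
Qed.

Lemma vanish_pt e f L v : hform e f -> v != 0 -> v \in val L -> f v = 0 -> vanish f L.
Proof.
move=> Hf v0 vL fv w; rewrite (projEpt v0 vL) => /vlineP[c ->].
by rewrite (hform_homog _ _ Hf) fv mulr0.
Qed.

Lemma nvanish e f L v : hform e f -> v \in val L -> v != 0 -> ~ vanish f L -> f v != 0.
Proof.
move=> Hf vL v0 nf; apply: contra_notN nf => /eqP fv.
exact: vanish_pt Hf v0 vL fv.
Qed.

(** The working form of closedness: a set is closed when forms vanishing on it
    separate it from the points outside it. *)
Lemma zclosedP Y : zclosed Y <-> forall L, ~ Y L ->
  exists e f, [/\ hform e f, (forall M, Y M -> vanish f M) & ~ vanish f L].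
Proof.
split.
- case=> I [HI YI] L nL; rewrite YI /zero_locus /= in nL.
  move/existsNP: nL => [p /not_implyP[Ip nv]].
  have [e He] := HI _ Ip.
  exists e, (fun v => p.@[coords v]); split => //.
  - by apply/hform_mpoly; exists p.
  - by move=> M; rewrite YI => /(_ p Ip).
- move=> sep.
  exists [set p | (exists e, p \is e.-homog) /\ forall M, Y M -> vanish (fun v => p.@[coords v]) M].
  split; first by move=> p [].
  apply/seteqP; split => L; first by move=> YL p [_ /(_ L YL)].
  move=> zL; apply: contrapT => /sep[e [f [/hform_mpoly[p Hp ->] fY nf]]].
  by apply: nf; apply: zL; split => //; exists e.
Qed.

Lemma zclosure_closed Y : zclosed (zclosure Y).
Proof.
apply/zclosedP => L /existsNP[C /not_implyP[[cC YC] CL]].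
have [e [f [Hf fC nf]]] := (zclosedP C).1 cC L CL; exists e, f; split => // M cM.
by apply: fC; apply: cM; split.
Qed.

Lemma sub_zclosure Y : Y `<=` zclosure Y.
Proof. by move=> L YL C [_]; exact. Qed.

(** The zero locus of one form is closed, so it contains the closure of every
    set on which the form vanishes. *)
Lemma hform_zclosure Y e f : hform e f -> (forall M, Y M -> vanish f M) ->
  forall M, zclosure Y M -> vanish f M.
Proof.
move=> Hf fY M /(_ [set L | vanish f L]); apply; split; last by move=> L /fY.
by apply/zclosedP => L nL; exists e, f; split.
Qed.

Lemma zclosed_form e f : hform e f -> zclosed [set L : proj V | vanish f L].
Proof. by move=> Hf; apply/zclosedP => L nL; exists e, f; split. Qed.

Lemma zclosedI Y Z : zclosed Y -> zclosed Z -> zclosed (Y `&` Z).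
Proof.
move=> /zclosedP HY /zclosedP HZ; apply/zclosedP => L /not_andP[/HY|/HZ] [e [f [Hf f0 nf]]];
  by exists e, f; split => // M [] *; apply: f0.
Qed.

(** Restricted to an irreducible set, the homogeneous coordinate ring is a
    domain. *)
Lemma zirreducible_mul Z a b f g : zirreducible Z -> hform a f -> hform b g ->
  (forall v, cone Z v -> f v * g v = 0) ->
  (forall v, cone Z v -> f v = 0) \/ (forall v, cone Z v -> g v = 0).
Proof.
move=> [_ irr] Hf Hg fg.
have [] := irr _ _ (zclosed_form Hf) (zclosed_form Hg).
- move=> L ZL; have [v v0 Lv] := projP L; have vL : v \in val L by rewrite Lv memv_line.
  have /eqP : f v * g v = 0 by apply: fg; exists L.
  by rewrite mulf_eq0 => /orP[] /eqP h; [left; apply: vanish_pt Hf _ vL _|right; apply: vanish_pt Hg _ vL _].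
- by move=> ZA; left => v [L /ZA vL]; apply: vL.
- by move=> ZA; right => v [L /ZA vL]; apply: vL.
Qed.

End Points.

(** The image of Y under the rational map P(V) --> P(W) induced by phi; points in
    the kernel of phi drop out because the members of P(W) have dimension 1. *)
Definition pimage (V W : vectType K) (phi : 'Hom(V, W)) (Y : set (proj V)) : set (proj W) :=
  [set M | exists2 L, Y L & val M = (phi @: val L)%VS].

End Forms.

(** * Growth of the Hilbert function *)

Section Hilbert.
Variable K : closedFieldType.

(** The Hilbert function of Y at e is at least N. *)
Definition hilb_ge (V : vectType K) (Y : set (proj V)) (e N : nat) : Prop :=
  exists (J : finType) (f : J -> V -> K),
  [/\ (N <= #|J|)%N, forall j, hform e (f j) &
      forall c : J -> K, (forall v, cone Y v -> \sum_j c j * f j v = 0) -> forall j, c j = 0].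

(** The Hilbert function of Y at e is at most N; the spanning functions are
    arbitrary, so that no degrees have to be tracked for them. *)
Definition hilb_le (V : vectType K) (Y : set (proj V)) (e N : nat) : Prop :=
  exists g : 'I_N -> V -> K, forall f, hform e f ->
    exists c : 'I_N -> K, forall v, cone Y v -> f v = \sum_i c i * g i v.

(** Growth of order k along the multiples of some A: sampling an arithmetic
    progression avoids rounding when the degrees of several forms are combined
    in [growsS]. *)
Definition grows (V : vectType K) (Y : set (proj V)) (k : nat) : Prop :=
  exists2 A, (0 < A)%N & forall t, hilb_ge Y (A * t) (t ^ k).

Section OneSpace.
Variable V : vectType K.
Implicit Types (L : proj V) (Y Z : set (proj V)) (v : V).

(** More independent forms than spanning functions would give a nonzero row in the
    kernel of the matrix of coefficients. *)
Lemma hilb_ge_le Y e N M : hilb_ge Y e N -> hilb_le Y e M -> (N <= M)%N.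
Proof.
move=> [J [f [NJ Hf find]]] [g Hg]; apply: leq_trans NJ _.
have [c Hc] := choice (fun j => Hg _ (Hf j)).
rewrite leqNgt; apply/negP => MJ.
pose A : 'M[K]_(#|J|, M) := \matrix_(i, j) c (enum_val i) j.
have kA : kermx A != 0.
  rewrite kermx_eq0 /row_free; apply: contraTneq MJ => rA.
  by rewrite -leqNgt -rA rank_leq_col.
have /sub_kermxP uA := nz_row_sub (kermx A).
move: kA; rewrite -nz_row_eq0; case/eqP; set u := nz_row _ in uA *.
have u0 : forall j : J, u 0 (enum_rank j) = 0.
  apply: find => v vY.
  under eq_bigr => j _ do rewrite (Hc j v vY) mulr_sumr.
  rewrite exchange_big big1 //= => i _.
  under eq_bigr => j _ do rewrite mulrA.
  rewrite -mulr_suml.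
  have /matrixP/(_ 0 i) := uA; rewrite !mxE.
  rewrite (reindex (@enum_rank J)) /=; last by apply: onW_bij; apply: enum_rank_bij.
  under eq_bigr => j _ do rewrite mxE enum_rankK.
  by move=> ->; rewrite mul0r.
by apply/rowP => i; rewrite mxE -(enum_valK i) u0.
Qed.

Lemma hilb_ge_sub Y Z e N : Y `<=` Z -> hilb_ge Y e N -> hilb_ge Z e N.
Proof.
move=> YZ [J [f [NJ Hf find]]]; exists J, f; split => // c Hc.
by apply: find => v [L /YZ ZL vL]; apply: Hc; exists L.
Qed.

(** A linear relation between forms of the same degree is a form, so it extends
    from Y to the closure of Y. *)
Lemma hilb_ge_zclosure Y e N : hilb_ge (zclosure Y) e N -> hilb_ge Y e N.
Proof.
move=> [J [f [NJ Hf find]]]; exists J, f; split => // c Hc.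
apply: find => v [L cL vL].
have Hs : hform e (fun v => \sum_j c j * f j v) by apply: hform_sum => j _; apply: hform_scale.
by apply: (hform_zclosure Hs _ cL) => // M YM w wM; apply: Hc; exists M.
Qed.

Lemma hilb_ge_mono Y e N M : (N <= M)%N -> hilb_ge Y e M -> hilb_ge Y e N.
Proof. by move=> NM [J [f [MJ Hf find]]]; exists J, f; split => //; apply: leq_trans NM MJ. Qed.

Lemma hilb_le_fin Y e (I : finType) (g : I -> V -> K) :
  (forall f, hform e f -> exists c : I -> K, forall v, cone Y v -> f v = \sum_i c i * g i v) ->
  hilb_le Y e #|I|.
Proof.
move=> Hg; exists (fun k => g (enum_val k)) => f /Hg[c Hc].
exists (fun k => c (enum_val k)) => v /Hc ->.
by rewrite (reindex (@enum_val I I)) //=; apply: onW_bij; apply: enum_val_bij.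
Qed.

Lemma hilb_le_mono Y e N M : (N <= M)%N -> hilb_le Y e N -> hilb_le Y e M.
Proof.
move=> NM [g Hg]; rewrite -(subnKC NM).
exists (fun k v => if split k is inl i then g i v else 0) => f /Hg[c Hc].
exists (fun k => if split k is inl i then c i else 0) => v /Hc ->.
rewrite big_split_ord /= [X in _ = _ + X]big1 ?addr0.
  by apply: eq_bigr => i _; rewrite (unsplitK (inl _)).
by move=> i _; rewrite (unsplitK (inr _)) mul0r.
Qed.

Lemma hge0 Y e : hilb_ge Y e 0.
Proof. by exists 'I_0, (fun _ _ => 0); split => // [[]|c _ []]. Qed.

Lemma hilb_ge_nonempty Y e N : (0 < N)%N -> hilb_ge Y e N -> Y !=set0.
Proof.
move=> N0 [J [f [NJ Hf find]]]; apply: contrapT => nY.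
have /card_gt0P[j _] := leq_trans N0 NJ.
have /(_ _ j)/eqP := find (fun=> 1); rewrite oner_eq0 => H; suff: false by [].
by apply: H => v [L YL _]; case: nY; exists L.
Qed.

(** Multiplication by f is injective on Z', and its image restricts to 0 on Z. *)
Lemma hilb_ge_add Z Z' a e f N M : Z `<=` Z' -> zirreducible Z' -> hform a f ->
  (forall v, cone Z v -> f v = 0) -> ~ (forall v, cone Z' v -> f v = 0) ->
  hilb_ge Z (a + e) N -> hilb_ge Z' e M -> hilb_ge Z' (a + e) (N + M).
Proof.
move=> ZZ' irr Hf fZ nfZ' [J [p [NJ Hp pind]]] [I [q [MI Hq qind]]].
exists (J + I)%type, (fun s => match s with inl j => p j | inr i => fun v => f v * q i v end).
split; first by rewrite card_sum leq_add.
  by case=> // i; apply: hform_mul.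
move=> c Hc.
have c1 : forall j, c (inl j) = 0.
  apply: (pind (fun j => c (inl j))) => v vZ.
  have vZ' : cone Z' v by case: vZ => L /ZZ' ? ?; exists L.
  rewrite -[RHS](Hc v vZ') big_sumType /= [X in _ = _ + X]big1 ?addr0 // => i _.
  by rewrite fZ // mul0r mulr0.
have Hq' : hform e (fun v => \sum_i c (inr i) * q i v).
  by apply: hform_sum => i _; apply: hform_scale.
have c2 : forall i, c (inr i) = 0.
  apply: (qind (fun i => c (inr i))).
  have [|//|//] := zirreducible_mul irr Hf Hq'.
  move=> v vZ'; rewrite -[RHS](Hc v vZ') big_sumType /= mulr_sumr.
  under [X in _ = X + _]eq_bigr => j _ do rewrite c1 mul0r.
  by rewrite big1_eq add0r; apply: eq_bigr => i _; rewrite mulrCA.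
by case.
Qed.

Lemma grows_sub Y Z k : Y `<=` Z -> grows Y k -> grows Z k.
Proof. by move=> YZ [A A0 H]; exists A => // t; apply: hilb_ge_sub YZ _. Qed.

Lemma grows0 Y : Y !=set0 -> grows Y 0.
Proof.
move=> [L YL]; exists 1%N => // t; rewrite mul1n expn0.
have [v v0 Lv] := projP L; have [i vi] := coordlP v0.
exists 'I_1, (fun _ v => coordl i v ^+ t); split; first by rewrite card_ord.
  by move=> _; have := hform_exp t (hform_linear (coordl i)); rewrite mul1n.
move=> c Hc j; have /eqP : \sum_(k < 1) c k * coordl i v ^+ t = 0.
  by apply: Hc; exists L => //; rewrite Lv memv_line.
rewrite big_ord1 mulf_eq0 expf_eq0 (negbTE vi) andbF orbF => /eqP.
by rewrite (ord1 j).
Qed.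

(** Iterating [hilb_ge_add] about t times adds t terms of order t ^ k.  The form f
    is replaced by f ^ A, whose degree is a multiple of A, so that the degrees
    met in the iteration remain on the progression where Z is known to grow. *)
Lemma growsS Z Z' a f k : Z !=set0 -> Z `<=` Z' -> zirreducible Z' -> hform a f ->
  (forall v, cone Z v -> f v = 0) -> ~ (forall v, cone Z' v -> f v = 0) ->
  grows Z k -> grows Z' k.+1.
Proof.
move=> [L ZL] ZZ' irr Hf fZ nfZ' [A A0 HA].
have a0 : (0 < a)%N.
  rewrite lt0n; apply/eqP => a0; move: Hf; rewrite a0 => Hf.
  by apply: nfZ' => v _; rewrite (hform_deg0 Hf v 0); apply: fZ; exists L; rewrite ?mem0v.
have HfA := hform_exp A Hf.
have fAZ v : cone Z v -> f v ^+ A = 0 by move/fZ ->; rewrite expr0n gtn_eqF.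
have nfAZ' : ~ (forall v, cone Z' v -> f v ^+ A = 0).
  by apply: contra_not nfZ' => H v /H /eqP; rewrite expf_eq0 => /andP[_ /eqP].
(* At stage i the degree is A a (t + i): starting at A a t leaves every
   intermediate value of h_Z at least t ^ k. *)
exists (A * (a * 2))%N; first by rewrite !muln_gt0 A0 a0.
move=> t; suff H i : hilb_ge Z' (A * (a * (t + i))) (i * t ^ k).
  by have := H t; rewrite addnn -mul2n expnS !mulnA.
elim: i => [|i IH]; first exact: hge0.
rewrite addnS mulnS mulnDr mulSn [(A * a)%N]mulnC; apply: hilb_ge_add fAZ nfAZ' _ IH => //.
have := HA (a + a * (t + i))%N; rewrite mulnDr [(A * a)%N]mulnC; apply: hilb_ge_mono.
case: k {HA} => // k; rewrite leq_exp2r // mulnDr addnCA; apply: leq_trans (leq_addr _ _).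
by rewrite leq_pmull.
Qed.

Lemma zchain_grows Y k : zchain Y k -> grows Y k.
Proof.
case=> Z [HZ lt]; suff H i : (i <= k)%N -> grows (Z i) i.
  by apply: grows_sub (H k (leqnn k)); have [_ [C _ ->]] := HZ k (leqnn k); apply: subIsetl.
elim: i => [|i IH] ik; first by apply: grows0; have [[]] := HZ 0 ik.
have [[Zi0 _] [C cC ZC]] := HZ i (ltnW ik); have [irr [C' _ ZC']] := HZ i.+1 ik.
have [sub nsub] := lt i ik.
have [L ZL nL] : exists2 L, Z i.+1 L & ~ Z i L.
  by move/existsNP: nsub => [L /not_implyP[]]; exists L.
have nCL : ~ C L.
  by move=> CL; apply: nL; rewrite ZC; split => //; move: ZL; rewrite ZC' => -[].
have [e [f [Hf fC nf]]] := (zclosedP C).1 cC L nCL.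
apply: growsS Zi0 sub irr Hf _ _ (IH (ltnW ik)).
  by move=> v [M + vM]; rewrite ZC => -[_ /fC]; apply.
by move=> H; apply: nf => v vL; apply: H; exists L.
Qed.

(** Taking t larger than c (A + 1) ^ m contradicts k > m. *)
Lemma grows_le Y k m c : grows Y k ->
  (forall e, hilb_le Y e (c * e.+1 ^ m)) -> (k <= m)%N.
Proof.
move=> [A A0 HA] HB; rewrite leqNgt; apply/negP => mk.
have Hle t : (t ^ k <= c * (A * t).+1 ^ m)%N by apply: hilb_ge_le (HA t) (HB _).
(* At t = C + 1 the bound reads t ^ k <= C t ^ m < t ^ (m + 1). *)
pose C := (c * A.+1 ^ m)%N.
have := Hle C.+1; apply/negP; rewrite -ltnNge.
apply: (@leq_ltn_trans (c * (A.+1 * C.+1) ^ m)%N).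
  rewrite leq_mul2l; apply/orP; right.
  by case: (m) => // m'; rewrite leq_exp2r // mulSn -addn1 addnC leq_add2r.
rewrite expnMn mulnA -/C; apply: (@leq_trans (C.+1 ^ m.+1)%N).
  by rewrite expnS ltn_pmul2r // expn_gt0.
by rewrite leq_pexp2l.
Qed.

End OneSpace.

(** Forms pull back along phi, and a relation on A descends to B. *)
Lemma hilb_ge_pimage (V W : vectType K) (phi : 'Hom(V, W)) (A : set (proj V)) (B : set (proj W)) e N :
  B `<=` pimage phi A -> hilb_ge B e N -> hilb_ge A e N.
Proof.
move=> BA [J [f [NJ Hf find]]]; exists J, (fun j v => f j (phi v)); split => //.
  by move=> j; apply: hform_comp.
move=> c Hc; apply: find => w [M /BA [L AL ->] /memv_imgP[v vL ->]].
by apply: Hc; exists L.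
Qed.

End Hilbert.

(** * Families of polynomials with graded coefficients *)

Section GradedFamilies.
Variables (K : closedFieldType) (W : vectType K).
Implicit Types (G H Q : W -> {poly K}).

(** A negative degree e - j has to mean the zero function, whereas the truncated
    subtraction would allow constants. *)
Definition graded_coef e j (h : W -> K) : Prop :=
  if (j <= e)%N then hform (e - j) h else forall w, h w = 0.

(** G is a form of degree e in w and in the variable of the polynomial jointly. *)
Definition graded e G : Prop := forall j, graded_coef e j (fun w => (G w)`_j).

Lemma graded_coef_ext e j (h h' : W -> K) : graded_coef e j h -> h =1 h' -> graded_coef e j h'.
Proof. by move=> H /funext <-. Qed.

Lemma graded_ext e G H : graded e G -> G =1 H -> graded e H.
Proof. by move=> gG /funext <-. Qed.

Lemma graded_add e G H : graded e G -> graded e H -> graded e (fun w => G w + H w).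
Proof.
move=> gG gH j; move: (gG j) (gH j); rewrite /graded_coef; case: ifP => _ hG hH.
  by apply: hform_ext (hform_add hG hH) _ => w; rewrite coefD.
by move=> w; rewrite coefD hG hH addr0.
Qed.

Lemma graded_mulform a e f G : hform a f -> graded e G -> graded (a + e) (fun w => f w *: G w).
Proof.
move=> Hf gG j; move: (gG j); rewrite /graded_coef; case: (leqP j e) => je hG.
  rewrite (leq_trans je (leq_addl _ _)) -addnBA //.
  by apply: hform_ext (hform_mul Hf hG) _ => w; rewrite coefZ.
case: ifP => _; last by move=> w; rewrite coefZ hG mulr0.
by apply: hform_ext (hform_zero _ _) _ => w; rewrite coefZ hG mulr0.
Qed.

Lemma graded_scale e c G : graded e G -> graded e (fun w => c *: G w).
Proof. exact: (graded_mulform (hform_const W c)). Qed.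

Lemma graded_mulX e G : graded e G -> graded e.+1 (fun w => G w * 'X).
Proof.
move=> gG [|j]; first by apply: hform_ext (hform_zero _ _) _ => w; rewrite coefMX.
by apply: (@graded_coef_ext _ _ (fun w => (G w)`_j)); [exact: gG | move=> w; rewrite coefMX].
Qed.

Lemma graded_zero e : graded e (fun=> 0).
Proof.
move=> j; rewrite /graded_coef; case: ifP => _; last by move=> w; rewrite coef0.
by apply: hform_ext (hform_zero _ _) _ => w; rewrite coef0.
Qed.

Lemma graded_coefZ e j a h Q : (j <= e + a)%N -> graded_coef e j h -> graded a Q ->
  graded (e + a - j) (fun w => h w *: Q w).
Proof.
move=> jea; rewrite /graded_coef; case: leqP => je Hh gQ.
  by rewrite addnC -addnBA // addnC; apply: graded_mulform.
by apply: graded_ext (graded_zero _) _ => w; rewrite Hh scale0r.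
Qed.

Lemma graded_sum e (I : Type) (r : seq I) (G : I -> W -> {poly K}) :
  (forall i, graded e (G i)) -> graded e (fun w => \sum_(i <- r) G i w).
Proof.
move=> gG; elim: r => [|i r IH].
  by apply: graded_ext (graded_zero e) _ => w; rewrite big_nil.
by apply: graded_ext (graded_add (gG i) IH) _ => w; rewrite big_cons.
Qed.

Lemma graded_size e G w : graded e G -> (size (G w) <= e.+1)%N.
Proof.
move=> gG; apply/leq_sizeP => j; rewrite ltnNge => /negbTE je.
by have := gG j; rewrite /graded_coef je.
Qed.

Section Division.
Variables (a : nat) (Q : W -> {poly K}).
Hypotheses (a0 : (0 < a)%N) (gQ : graded a Q) (mQ : forall w, Q w \is monic)
  (sQ : forall w, size (Q w) = a.+1).

(** Passing from X ^ j to X ^ (j + 1), the remainder is multiplied by X and its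
    top coefficient is cleared by one multiple of the monic Q. *)
Lemma graded_modXn j : graded j (fun w => 'X^j %% Q w).
Proof.
elim: j => [|j IH].
  have -> : (fun w => 'X^0 %% Q w) = fun=> 1%:P.
    by apply/funext => w; rewrite modp_small ?expr0 // sQ size_poly1 ltnS.
  move=> [|j] /=; first by apply: hform_ext (hform_const _ 1) _ => w; rewrite coefC.
  by move=> w; rewrite coefC.
have Q0 w : Q w != 0 by rewrite monic_neq0.
have szR w : (size ('X^j %% Q w)%R <= a)%N by rewrite -ltnS -(sQ w) ltn_modpN0.
have E w : 'X^(j.+1) %% Q w =
    ('X^j %% Q w) * 'X + (- 1) *: (('X^j %% Q w)`_a.-1 *: Q w).
  rewrite scaleN1r; set r := 'X^j %% _.
  have -> : 'X^(j.+1) %% Q w = ('X * r) %% Q w by rewrite /r modp_mul -exprS.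
  rewrite ['X * r]mulrC -{1}[r * 'X](subrK (r`_a.-1 *: Q w)).
  rewrite -mul_polyC modpD modp_mull addr0 modp_small // sQ ltnS.
  apply/leq_sizeP => i; rewrite leq_eqVlt coefB coefMX mul_polyC coefZ => /predU1P[<-|ai].
    rewrite gtn_eqF //; have /monicP := mQ w; rewrite lead_coefE sQ /= => ->.
    by rewrite mulr1 subrr.
  have -> : (Q w)`_i = 0 by apply/(leq_sizeP _ a.+1); rewrite ?sQ.
  rewrite mulr0 subr0; case: i ai => // i ai /=.
  by apply: (leq_sizeP _ _ (szR w)).
apply: (graded_ext _ (fsym E)); apply: graded_add; first exact: graded_mulX.
apply: graded_scale.
have := graded_coefZ _ (IH a.-1) gQ.
have -> : (j + a - a.-1 = j.+1)%N by rewrite -[in LHS](prednK a0) addnS subSn ?leq_addl // addnK.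
by apply; apply: leq_trans (leq_pred _) (leq_addl _ _).
Qed.

(** Division by a monic graded family preserves the grading, which keeps every
    coefficient of the remainder a form. *)
Lemma graded_mod e G : graded e G -> graded e (fun w => G w %% Q w).
Proof.
move=> gG.
have E w : G w %% Q w = \sum_(j < e.+1) (G w)`_j *: ('X^j %% Q w).
  have {1}-> : G w = \sum_(j < e.+1) (G w)`_j *: 'X^j.
    rewrite -poly_def; apply/polyP => i; rewrite coef_poly; case: ltnP => // ei.
    exact: (leq_sizeP _ _ (graded_size w gG)).
  by rewrite (big_morph _ (modpD (Q w)) (mod0p _)); apply: eq_bigr => j _; rewrite modpZl.
apply: (graded_ext _ (fsym E)); apply: graded_sum => j.
have := graded_coefZ _ (gG j) (graded_modXn j).
by rewrite addnK; apply; apply: leq_addl.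
Qed.

End Division.

(** With row weights e + i and column weights j, each term of the expansion
    along a permutation has degree sum (e + i) - sum j = e a. *)
Lemma hform_det a e (A : W -> 'M[K]_a) :
  (forall i j : 'I_a, graded_coef (e + i) j (fun w => A w i j)) ->
  hform (e * a) (fun w => \det (A w)).
Proof.
move=> gA; rewrite /determinant; apply: hform_sum => s _; apply: hform_scale.
have [ok|] := boolP [forall i, s i <= e + i]%N; last first.
  rewrite negb_forall => /existsP[i /negbTE si].
  apply: hform_ext (hform_zero _ _) _ => w; rewrite (bigD1 i) //=.
  by have := gA i (s i); rewrite /graded_coef si => ->; rewrite mul0r.
have -> : (e * a = \sum_(i < a) (e + i - s i))%N.
  rewrite sumnB; last by move=> i _; exact: (forallP ok).
  rewrite big_split /= sum_nat_const card_ord mulnC.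
  by rewrite -(reindex_inj (h := s) (P := xpredT) (F := fun i : 'I_a => i : nat) (@perm_inj _ s)) /= addnK.
apply: hform_prod => i; have := gA i (s i); rewrite /graded_coef.
by move/forallP: ok => ->.
Qed.

End GradedFamilies.

(** * Projection from a point *)

Section Projection.
Variable K : closedFieldType.

(** Coordinates adapted to the projection from p: a vector is determined by its
    projection to W and by its height along p. *)
Record point_projection (V W : vectType K) (p : V) := PointProjection {
  prj : 'Hom(V, W);
  lft : 'Hom(W, V);
  hgt : 'Hom(V, K^o);
  prj_dec : forall v, v = lft (prj v) + hgt v *: p;
  lftK : forall w, prj (lft w) = w;
  prj_p : prj p = 0 }.

Lemma exists_point_projection (V : vectType K) (p : V) : p != 0 ->
  exists (W : vectType K) (D : point_projection W p), \dim {:V} = (\dim {:W}).+1.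
Proof.
move=> p0; have [i pi] := coordlP p0.
pose x : 'Hom(V, K^o) := (coordl i p)^-1 *: coordl i.
have xp : x p = 1 by rewrite /x scale_lfunE /GRing.scale /= mulVf.
pose U := lker x.
pose q : 'Hom(V, V) := (\1 - linfun (fun v => x v *: p))%VF.
have qE v : q v = v - x v *: p.
  rewrite /q add_lfunE opp_lfunE id_lfunE; congr (_ - _).
  pose g v := x v *: p.
  have lg : linear g.
    by move=> c u w; rewrite /g linearP scalerDl -scalerA.
  pose gL := GRing.isLinear.Build K V V _ g lg.
  pose gl : {linear V -> V} := HB.pack g gL.
  by rewrite (lfunE gl).
have qU v : q v \in U by rewrite memv_ker qE linearB linearZ /= xp /GRing.scale /= mulr1 subrr.
pose pr : 'Hom(V, subvs_of U) := (linfun (vsproj U) \o q)%VF.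
have prE v : pr v = vsproj U (q v) by rewrite comp_lfunE lfunE.
pose lf : 'Hom(subvs_of U, V) := linfun vsval.
have lfE w : lf w = vsval w by rewrite lfunE.
have xU (w : subvs_of U) : x (vsval w) = 0 by apply/eqP; rewrite -memv_ker subvsP.
exists (subvs_of U).
unshelve eexists (@PointProjection V (subvs_of U) p pr lf x _ _ _).
- by move=> v; rewrite prE lfE vsprojK // qE subrK.
- by move=> w; rewrite prE lfE qE xU scale0r subr0 vsvalK.
- by rewrite prE qE xp scale1r subrr linear0.
have -> : \dim {:subvs_of U} = \dim U by rewrite dimvf.
rewrite -(limg_ker_dim x fullv) capfv.
suff -> : \dim (limg x) = 1%N by rewrite addn1.
apply/eqP; rewrite eqn_leq; apply/andP; split.
  by apply: leq_trans (dimvS (subvf _)) _; rewrite dimvf.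
rewrite lt0n dimv_eq0; apply: contraTneq (memv_img x (memvf p)) => ->.
by rewrite memv0 xp oner_eq0.
Qed.

End Projection.

(** * Elimination of one variable *)

Section Elimination.
Variables (K : closedFieldType) (V W : vectType K) (p : V) (D : point_projection W p).
Local Notation π := (prj D).
Local Notation ι := (lft D).
Local Notation x := (hgt D).

Lemma prj_lft_add w s : π (ι w + s *: p) = w.
Proof. by rewrite linearD linearZ /= lftK prj_p scaler0 addr0. Qed.

(** A linear factor l becomes l w + (l p) X on the line through w in the
    direction p, so the top coefficients multiply to the value at p. *)
Lemma hform_expand e (f : V -> K) : hform e f ->
  exists G : W -> {poly K}, [/\ graded e G,
     forall w s, (G w).[s] = f (ι w + s *: p) & forall w, (G w)`_e = f p].
Proof.
elim=> [c|a l g _ [G [gG HG Gp]]|a g h _ [G [gG HG Gp]] _ [H [gH HH Hp]]].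
- exists (fun=> c%:P); split; [|by move=> *; rewrite hornerC|by move=> *; rewrite coefC].
  move=> [|j]; first by apply: hform_ext (hform_const _ c) _ => w; rewrite coefC.
  by move=> w; rewrite coefC.
- exists (fun w => l (ι w) *: G w + l p *: (G w * 'X)); split.
  + apply: graded_add; last by apply: graded_scale; apply: graded_mulX.
    rewrite -add1n; apply: (@graded_mulform _ _ _ _ (fun w => l (ι w))) => //.
    by apply: hform_comp; apply: hform_linear.
  + move=> w s; rewrite hornerD !hornerZ hornerMX HG linearD linearZ /=.
    by rewrite mulrDl /GRing.scale /= mulrA mulrAC [s * _]mulrC.
  + move=> w; rewrite coefD !coefZ coefMX /= Gp.
    rewrite [(G w)`_a.+1](leq_sizeP _ _ (graded_size w gG)) //.
    by rewrite mulr0 add0r.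
- exists (fun w => G w + H w); split; first exact: graded_add.
  + by move=> w s; rewrite hornerD HG HH.
  + by move=> w; rewrite coefD Gp Hp.
Qed.

(** The coefficients of R are forms on W, hence combinations of N functions on
    Y'; the products of these with the b powers of the height span on Y. *)
Lemma hilb_le_graded (Y : set (proj V)) (Y' : set (proj W)) e b N :
  (forall v, cone Y v -> cone Y' (π v)) ->
  (forall f, hform e f -> exists R : W -> {poly K}, [/\ graded e R,
     forall w, (size (R w) <= b)%N & forall v, cone Y v -> f v = (R (π v)).[x v]]) ->
  (forall e', (e' <= e)%N -> hilb_le Y' e' N) -> hilb_le Y e (b * N).
Proof.
move=> YY' HR HN.
have [|g Hg] := @choice nat ('I_N -> W -> K) (fun j g => forall h, graded_coef e j h ->
    exists c : 'I_N -> K, forall w, cone Y' w -> h w = \sum_i c i * g i w).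
  move=> j; rewrite /graded_coef; case: leqP => je.
    by have [g Hg] := HN (e - j)%N (leq_subr _ _); exists g.
  exists (fun _ _ => 0) => h h0; exists (fun=> 0) => w _.
  by rewrite h0 big1 // => i _; rewrite mul0r.
have -> : (b * N = #|{: 'I_b * 'I_N}|)%N by rewrite card_prod !card_ord.
apply: (@hilb_le_fin _ _ _ _ _ (fun (ij : 'I_b * 'I_N) v => g ij.1 ij.2 (π v) * x v ^+ ij.1)).
move=> f /HR[R [gR sR fR]]; have [c Hc] := choice (fun j => Hg j _ (gR j)).
exists (fun ij : 'I_b * 'I_N => c ij.1 ij.2) => v vY.
rewrite fR // (horner_coef_wide _ (sR _)).
rewrite -(pair_bigA _ (fun (j : 'I_b) i => c j i * (g j i (π v) * x v ^+ j))) /=.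
apply: eq_bigr => j _; rewrite (Hc j _ (YY' v vY)) mulr_suml.
by apply: eq_bigr => i _; rewrite mulrA.
Qed.

Section AvoidingCenter.
Variable Y : set (proj V).
Hypotheses (cY : zclosed Y) (Y0 : Y !=set0) (p0 : p != 0) (pY : ~ Y (pt p0)).

(** A form vanishing on Y but not at p has an invertible constant as its top
    coefficient in the height, hence can be made monic. *)
Lemma monic_equation : exists a (Q : W -> {poly K}),
  [/\ (0 < a)%N, graded a Q, forall w, Q w \is monic, forall w, size (Q w) = a.+1 &
      forall v, cone Y v -> (Q (π v)).[x v] = 0].
Proof.
have [a [f [Hf fY nf]]] := (zclosedP Y).1 cY _ pY.
have fp : f p != 0 by apply: nvanish Hf _ p0 nf; rewrite memv_line.
have [G [gG HG Gp]] := hform_expand Hf.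
pose Q w := (f p)^-1 *: G w.
have gQ : graded a Q by apply: graded_scale.
have Qa w : (Q w)`_a = 1 by rewrite coefZ Gp mulVf.
have sQ w : size (Q w) = a.+1.
  apply/eqP; rewrite eqn_leq (graded_size w gQ) ltnNge; apply/negP => /leq_sizeP/(_ a (leqnn a)).
  by apply/eqP; rewrite Qa oner_eq0.
exists a, Q; split => //.
- rewrite lt0n; apply/eqP => a0; case: Y0 => L YL; have [v v0 Lv] := projP L.
  case/eqP: fp; move: Hf; rewrite a0 => /hform_deg0 /(_ p v) ->; apply: (fY L YL v).
  by rewrite Lv memv_line.
- by move=> w; rewrite monicE lead_coefE sQ /= Qa.
- move=> v [L YL vL]; rewrite hornerZ HG -prj_dec.
  by rewrite (fY L YL v vL) mulr0.
Qed.

(** After multiplying by powers of y to reach a common degree, a general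
    combination of two forms is nonzero wherever one of them is: the field is
    infinite. *)
Lemma avoid_form (vs : seq V) (y : V -> K) : hform 1 y ->
  (forall v, v \in vs -> y v != 0 /\
     exists e f, [/\ hform e f, (forall M, Y M -> vanish f M) & f v != 0]) ->
  exists e f, [/\ hform e f, (forall M, Y M -> vanish f M) & forall v, v \in vs -> f v != 0].
Proof.
move=> Hy; elim: vs => [|v vs IH] H.
  by exists 0, (fun=> 0); split => //; apply: hform_zero.
have [u uvs|e [f [Hf fY fvs]]] := IH; first by apply: H; rewrite inE uvs orbT.
have [_ [e' [g [Hg gY gv]]]] := H v (mem_head _ _).
have yN0 u : u \in v :: vs -> y u != 0 by move=> /H [].
pose F u := f u * y u ^+ e'; pose G u := y u ^+ e * g u.
have HF : hform (e + e') F by apply: hform_mul Hf _; have := hform_exp e' Hy; rewrite mul1n.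
have HG : hform (e + e') G by apply: hform_mul => //; have := hform_exp e Hy; rewrite mul1n.
(* A value t outside the roots of P makes F + t G nonzero on the whole list. *)
pose P := \prod_(u <- v :: vs) ((F u)%:P + G u *: 'X).
have : P != 0.
  rewrite prodf_seq_neq0; apply/allP => u uvs /=.
  suff : (F u != 0) || (G u != 0).
    apply: contraTneq => P0; rewrite negb_or !negbK.
    have := congr1 (fun q : {poly K} => q`_0) P0.
    have := congr1 (fun q : {poly K} => q`_1) P0.
    rewrite !coefD !coefC !coefZ !coefX /= mulr1 mulr0 add0r addr0 => -> ->.
    by rewrite eqxx.
  rewrite /F /G !mulf_eq0 !expf_eq0 (negbTE (yN0 u uvs)) !andbF orbF /=.
  by move: uvs; rewrite inE => /predU1P[->|/fvs ->//]; rewrite gv orbT.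
move=> /closed_nonrootP[t nt]; exists (e + e')%N, (fun u => F u + t * G u); split.
- by apply: hform_add => //; apply: hform_scale.
- by move=> M YM u uM; rewrite /F /G (fY M YM u uM) (gY M YM u uM) !(mul0r, mulr0) addr0.
- move=> u uvs; apply: contraNneq nt => H0; apply/rootP.
  rewrite horner_prod; apply/eqP; rewrite prodf_seq_eq0; apply/hasP; exists u => //=.
  by rewrite hornerD hornerC hornerZ hornerX [G u * t]mulrC H0.
Qed.

(** Let w0 lie outside the image.  Over w0 the monic equation has finitely many
    roots, none of which gives a point of Y, so a single form f vanishing on Y
    is nonzero at all of them.  The determinant of multiplication by f modulo
    the monic equation is a form on W.  It vanishes at the image of a point of
    Y, where the powers of the height form a kernel vector.  It is nonzero at
    w0, where f is invertible modulo the equation. *)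
Lemma pimage_prj_closed : zclosed (pimage π Y).
Proof.
have [a [Q [a0 gQ mQ sQ rQ]]] := monic_equation.
apply/zclosedP => M nM; have [w0 w00 Mw] := projP M.
have [rs Qrs] := closed_field_poly_normal (Q w0).
have [i wi] := coordlP w00.
have vr0 r : ι w0 + r *: p != 0.
  by apply: contraNneq w00 => E; rewrite -(prj_lft_add w0 r) E linear0.
have Hy : hform 1 (fun v => coordl i (π v)) by apply: hform_comp; apply: hform_linear.
have [|e [f [Hf fY fr]]] := @avoid_form [seq ι w0 + r *: p | r <- rs] _ Hy.
  move=> _ /mapP[r _ ->]; split; first by rewrite prj_lft_add.
  have nL : ~ Y (pt (vr0 r)).
    move=> YL; apply: nM; exists (pt (vr0 r)) => //.
    by rewrite Mw /= limg_line prj_lft_add.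
  have [e [f [Hf fY nf]]] := (zclosedP Y).1 cY _ nL.
  by exists e, f; split => //; apply: nvanish Hf _ (vr0 r) nf; rewrite memv_line.
have [P [gP HP _]] := hform_expand Hf.
pose A w : 'M[K]_a := \matrix_(i, j) (('X^i * P w) %% Q w)`_j.
have gR (k : nat) : graded (e + k) (fun w => ('X^k * P w) %% Q w).
  apply: (graded_mod a0 gQ mQ sQ).
  elim: k => [|k IH]; first by rewrite addn0; apply: graded_ext gP _ => w; rewrite mul1r.
  rewrite addnS; apply: graded_ext (graded_mulX IH) _ => w.
  by rewrite exprSr mulrAC.
have HA : hform (e * a) (fun w => \det (A w)).
  by apply: hform_det => k j; apply: graded_coef_ext (gR k j) _ => w; rewrite mxE.
have szR w q : (size (q %% Q w)%R <= a)%N by rewrite -ltnS -(sQ w) ltn_modpN0 ?monic_neq0.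
exists (e * a)%N, (fun w => \det (A w)); split => //.
- move=> M' [L YL ML] w; rewrite ML => /memv_imgP[v vL ->{w}].
  apply/eqP; rewrite -det_tr; apply/det0P.
  exists (\row_j x v ^+ j).
    apply/eqP => /rowP/(_ (Ordinal a0)); rewrite !mxE expr0 => /eqP.
    by rewrite oner_eq0.
  apply/rowP => k; rewrite !mxE.
  transitivity (('X^k * P (π v)) %% Q (π v)).[x v].
    rewrite (horner_coef_wide _ (szR _ _)); apply: eq_bigr => j _.
    by rewrite !mxE mulrC.
  have Qv : (Q (π v)).[x v] = 0 by apply: rQ; exists L.
  have := congr1 (horner^~ (x v)) (divp_eq ('X^k * P (π v)) (Q (π v))).
  rewrite /= hornerD hornerM [X in _ * X]HP -prj_dec (fY L YL v vL) mulr0.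
  by rewrite hornerM Qv mulr0 add0r => <-.
- move=> /(_ w0); rewrite Mw memv_line => /(_ isT) /eqP/det0P[u u0 uA].
  case/eqP: u0; pose U := \sum_(k < a) u 0 k *: 'X^k.
  have UP0 : (U * P w0) %% Q w0 = 0.
    apply/polyP => j; rewrite coef0; case: (ltnP j a) => ja; last exact: (leq_sizeP _ _ (szR w0 _)).
    have /rowP/(_ (Ordinal ja)) := uA; rewrite !mxE => E; rewrite -[RHS]E.
    rewrite mulr_suml (big_morph _ (modpD (Q w0)) (mod0p _)) coef_sum.
    by apply: eq_bigr => k _; rewrite -scalerAl modpZl coefZ mxE.
  have cop : coprimep (Q w0) (P w0).
    apply/Pdiv.ClosedField.coprimepP => r rQr.
    rewrite HP; apply: fr; apply: map_f.
    move: rQr; rewrite Qrs (monicP (mQ w0)) scale1r.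
    by rewrite root_prod_XsubC.
  have U0 : U = 0.
    apply/eqP; apply: contraT => /dvdp_leq/(_ (_ : Q w0 %| U)).
    rewrite -(Gauss_dvdpl _ cop) (introT (modp_eq0P _ _) UP0) sQ => /(_ isT).
    rewrite ltnNge => /negP[]; apply/leq_sizeP => j aj.
    rewrite coef_sum big1 // => k _; rewrite coefZ coefXn gtn_eqF ?mulr0 //.
    exact: leq_trans (ltn_ord k) aj.
  apply/rowP => k; have := congr1 (fun q : {poly K} => q`_k) U0.
  rewrite coef0 coef_sum (bigD1 k) //= coefZ coefXn eqxx mulr1 big1 ?addr0 ?mxE //.
  move=> i' ne; rewrite coefZ coefXn (_ : (k == i' :> nat) = false) ?mulr0 //.
  by apply/negbTE; rewrite eq_sym.
Qed.

Lemma prj_fibre_finite (M : proj W) :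
  exists s : seq (proj V), forall L, Y L -> val M = (π @: val L)%VS -> L \in s.
Proof.
have [a [Q [a0 gQ mQ sQ rQ]]] := monic_equation.
have [w0 w00 Mw] := projP M.
have [rs Qrs] := closed_field_poly_normal (Q w0).
have vr0 r : ι w0 + r *: p != 0.
  by apply: contraNneq w00 => E; rewrite -(prj_lft_add w0 r) E linear0.
exists [seq pt (vr0 r) | r <- rs] => L YL ML.
have /memv_imgP[v vL wv] : w0 \in (π @: val L)%VS by rewrite -ML Mw memv_line.
have Ev : v = ι w0 + x v *: p by rewrite {1}(prj_dec D v) wv.
apply/mapP; exists (x v); last by apply: projEpt; rewrite -Ev.
have /rootP : (Q (π v)).[x v] = 0 by apply: rQ; exists L.
by rewrite -wv Qrs (monicP (mQ w0)) scale1r root_prod_XsubC.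
Qed.

(** Only a point equal to p could be killed by the projection. *)
Lemma prj_point L : Y L -> exists M : proj W, val M = (π @: val L)%VS.
Proof.
move=> YL; have [u u0 Lu] := projP L.
suff πu : π u != 0 by exists (pt πu); rewrite Lu limg_line.
apply: contra_notN pY => /eqP πu; suff -> : pt p0 = L by [].
have Eu := prj_dec D u; rewrite πu linear0 add0r in Eu.
apply/esym/projEpt; have xu : x u != 0 by apply: contraNneq u0 => xu; rewrite Eu xu scale0r.
by rewrite Lu; apply/vlineP; exists (x u)^-1; rewrite {2}Eu scalerA mulVf // scale1r.
Qed.

(** The monic equation reduces every form to a polynomial of bounded size in the
    height. *)
Lemma hilb_le_prj : exists a, forall e N,
  (forall e', (e' <= e)%N -> hilb_le (pimage π Y) e' N) -> hilb_le Y e (a * N).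
Proof.
have [a [Q [a0 gQ mQ sQ rQ]]] := monic_equation; exists a => e N.
apply: hilb_le_graded.
  move=> v [L YL vL]; have [M ML] := prj_point YL.
  by exists M; [exists L | rewrite ML memv_img].
move=> f Hf; have [G [gG HG _]] := hform_expand Hf.
exists (fun w => G w %% Q w); split; first exact: (graded_mod a0 gQ mQ sQ gG).
  by move=> w; rewrite -ltnS -(sQ w) ltn_modpN0 ?monic_neq0.
move=> v vY; have := congr1 (horner^~ (x v)) (divp_eq (G (π v)) (Q (π v))).
by rewrite /= hornerD hornerM rQ // mulr0 add0r HG -prj_dec => ->.
Qed.

End AvoidingCenter.
End Elimination.

(** * Lifting chains of irreducible closed sets *)

Section Chains.
Variable K : closedFieldType.

Definition closed_chain (V : vectType K) (k : nat) (Z : nat -> set (proj V)) : Prop :=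
  (forall i, (i <= k)%N -> zirreducible (Z i) /\ zclosed (Z i)) /\
  (forall i, (i < k)%N -> Z i `<` Z i.+1).

Lemma closed_chain_zchain (V : vectType K) (Y : set (proj V)) k Z :
  closed_chain k Z -> Z k `<=` Y -> zchain Y k.
Proof.
move=> [HZ lt] ZY; exists Z; split=> // i ik; have [irr cl] := HZ i ik.
split=> //; exists (Z i) => //; apply/esym/setIidr.
suff H j : (j <= k)%N -> Z (k - j)%N `<=` Y by rewrite -(subKn ik); apply/H/leq_subr.
elim: j => [|j IH] jk; first by rewrite subn0.
apply: subset_trans (IH (ltnW jk)); have [] := lt (k - j.+1)%N _.
  by rewrite subnS prednK ?leq_subr // subn_gt0.
by rewrite subnSK.
Qed.

Lemma pimage_sub (V W : vectType K) (phi : 'Hom(V, W)) (A B : set (proj V)) :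
  A `<=` B -> pimage phi A `<=` pimage phi B.
Proof. by move=> AB M [L /AB BL ML]; exists L. Qed.

Section Lifting.
Variables (V W : vectType K) (p : V) (D : point_projection W p) (p0 : p != 0).
Variable Y : set (proj V).
Hypotheses (cY : zclosed Y) (pY : ~ Y (pt p0)).
Local Notation π := (prj D).

Lemma pimage_closed_sub C : zclosed C -> C `<=` Y -> zclosed (pimage π C).
Proof.
move=> cC CY; have [C0|nC] := pselect (C !=set0).
  by apply: (pimage_prj_closed D cC C0 (fun H => pY (CY _ H))).
apply/zclosedP => M _; exists 0, (fun=> 1); split; first exact: hform_const.
  by move=> M' [L CL]; case: nC; exists L.
by move=> /(_ 0 (mem0v _)) /eqP; rewrite oner_eq0.
Qed.

(** Forms pull back along the projection, which is defined on all of Y. *)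
Lemma closed_preimage C Z' : zclosed C -> C `<=` Y -> zclosed Z' ->
  zclosed (C `&` [set L | exists2 M, Z' M & val M = (π @: val L)%VS]).
Proof.
move=> cC CY cZ'; apply/zclosedP => L nL; have [CL|nCL] := pselect (C L); last first.
  have [e [f [Hf fC nf]]] := (zclosedP C).1 cC L nCL; exists e, f; split => //.
  by move=> M [/fC].
have [M ML] := prj_point D pY (CY _ CL).
have nM : ~ Z' M by move=> Z'M; apply: nL; split => //; exists M.
have [e [f [Hf fZ nf]]] := (zclosedP Z').1 cZ' M nM.
exists e, (fun v => f (π v)); split; first exact: hform_comp.
  by move=> L' [_ [M' Z'M' ML']] v vL; apply: (fZ M' Z'M'); rewrite ML' memv_img.
by move=> H; apply: nf => w; rewrite ML => /memv_imgP[v vL ->]; apply: H.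
Qed.

(** A nested family of sets, each of which misses some point of a finite list,
    misses one common point of it. *)
Lemma total_fibre (F : set (set (proj V))) (s : seq (proj V)) : F !=set0 -> total_on F subset ->
  (forall X, F X -> exists2 L, L \in s & ~ X L) -> exists2 L, L \in s & forall X, F X -> ~ X L.
Proof.
move=> [X0 FX0] tot H; apply: contrapT => nH.
have {}nH L : L \in s -> exists2 X, F X & X L.
  move=> Ls; apply: contrapT => nX; apply: nH; exists L => // X FX XL.
  by apply: nX; exists X.
suff [X FX sX] : exists2 X, F X & forall L, L \in s -> X L.
  by have [L /sX] := H X FX.
elim: s {H} nH => [|L s IH] nH; first by exists X0.
have [X FX XL] := nH L (mem_head _ _).
have [L' L's|X' FX' sX'] := IH; first by apply: nH; rewrite inE L's orbT.
have [sub|sub] := tot X X' FX FX'.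
  by exists X' => // L'; rewrite inE => /predU1P[->|/sX'//]; apply: sub.
by exists X => // L'; rewrite inE => /predU1P[->//|/sX']; apply: sub.
Qed.

(** A minimal closed subset of C mapping onto Z' is irreducible, because images
    of closed sets are closed and Z' is irreducible.  Minimal sets exist by
    Zorn's lemma: the intersection of a nested family still meets every fibre,
    as fibres are finite.  This replaces the decomposition into irreducible
    components and hence the Hilbert basis theorem. *)
Lemma lift_irreducible C Z' : zclosed C -> C `<=` Y -> zclosed Z' -> zirreducible Z' ->
  Z' `<=` pimage π C ->
  exists Z, [/\ zclosed Z, zirreducible Z, Z `<=` C & pimage π Z = Z'].
Proof.
move=> cC0 C0Y cZ' [Z'0 irr'] Z'C0.
pose C1 := C `&` [set L | exists2 M, Z' M & val M = (π @: val L)%VS].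
have cC : zclosed C1 by apply: closed_preimage.
have CC0 : C1 `<=` C by apply: subIsetl.
have CY : C1 `<=` Y by apply: subset_trans C0Y.
have Z'C : Z' `<=` pimage π C1.
  by move=> M Z'M; have [L CL ML] := Z'C0 M Z'M; exists L => //; split => //; exists M.
(* The union lemma yields maximal sets; it is applied to complements in C1. *)
pose P (A : set (proj V)) := zclosed (C1 `\` A) /\ Z' `<=` pimage π (C1 `\` A).
have [F FP totF|A [[cA Z'A] maxA]] := @Zorn_bigcup _ P.
  split.
    apply/zclosedP => L nL.
    have [[X FX nXL]|H] := pselect (exists2 X, F X & ~ (C1 `\` X) L).
      have [cX _] := FP X FX; have [e [f [Hf fX nf]]] := (zclosedP _).1 cX L nXL.
      exists e, f; split => // M [CM nM]; apply: fX; split => // XM.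
      by apply: nM; exists X.
    have nCL : ~ C1 L.
      move=> CL; apply: nL; split => // -[X FX XL]; apply: H; exists X => //.
      by case.
    have [e [f [Hf fC nf]]] := (zclosedP _).1 cC L nCL; exists e, f; split => //.
    by move=> M [/fC].
  move=> M Z'M; have [nF|F0] := pselect (F !=set0); last first.
    have [L CL ML] := Z'C M Z'M; exists L => //; split => // -[X FX _].
    by apply: F0; exists X.
  have [Y0] : Y !=set0 by have [L /CY] := Z'C M Z'M; exists L.
  move=> Y0'; have [s Hs] := prj_fibre_finite D cY (ex_intro _ Y0 Y0') pY M.
  pose s' := [seq L <- s | `[< C1 L /\ val M = (π @: val L)%VS >]].
  have [X FX|L] := @total_fibre F s' nF totF.
    have [_ /(_ M Z'M)[L [CL nXL] ML]] := FP X FX.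
    exists L => //; rewrite mem_filter Hs // ?andbT; last exact: CY.
    by apply/asboolP.
  rewrite mem_filter => /andP[/asboolP[CL ML] _] nL; exists L => //; split => //.
  by move=> [X /nL].
exists (C1 `\` A).
have sub : C1 `\` A `<=` C1 by apply: subDsetl.
have half B : zclosed B -> Z' `<=` pimage π ((C1 `\` A) `&` B) -> C1 `\` A `<=` B.
  move=> cB Z'B; apply: contrapT => nsub.
  apply: (maxA (~` ((C1 `\` A) `&` B))).
    split; first by move=> L AL [[]].
    move=> H; apply: nsub => L [CL nA]; apply: contrapT => nB.
    by apply: nA; apply: H => -[].
  rewrite /P; have -> : C1 `\` ~` ((C1 `\` A) `&` B) = (C1 `\` A) `&` B.
    apply/seteqP; split => L; first by move=> [_ /contrapT].
    by move=> [[CL nA] BL]; split => //; apply.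
  by split => //; apply: zclosedI.
split => //; last 2 first.
- exact: subset_trans CC0.
- apply/seteqP; split => // M [L [[_ [M' Z'M' ML']] _] ML].
  by have -> : M = M' by apply/val_inj; rewrite ML ML'.
split; first by case: Z'0 => M /Z'A[L ZL _]; exists L.
move=> B1 B2 cB1 cB2 cover.
have cI B : zclosed B -> zclosed (pimage π ((C1 `\` A) `&` B)).
  by move=> cB; apply: pimage_closed_sub; [apply: zclosedI | move=> L [[/CY]]].
have [||] := irr' _ _ (cI B1 cB1) (cI B2 cB2).
- move=> M /Z'A[L ZL ML]; have [BL|BL] := cover L ZL; [left|right]; by exists L.
- by left; apply: half.
- by right; apply: half.
Qed.

(** Lift the top member first, then lift the next one inside the set obtained;
    inclusions stay strict because the images differ. *)
Lemma lift_chain k Z' C : closed_chain k Z' -> zclosed C -> C `<=` Y ->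
  Z' k `<=` pimage π C ->
  exists Z, [/\ closed_chain k Z, Z k `<=` C & pimage π (Z k) = Z' k].
Proof.
elim: k C => [|k IH] C [HZ' lt] cC CY sub.
  have [irr cl] := HZ' 0 (leqnn 0).
  have [Z [cZ iZ ZC ZZ']] := lift_irreducible cC CY cl irr sub.
  by exists (fun=> Z).
have [irr cl] := HZ' k.+1 (leqnn _).
have [Zt [cZ iZ ZC ZZ']] := lift_irreducible cC CY cl irr sub.
have [||||Z [[HZ ltZ] ZkZ Zk]] := IH Zt => //.
- by split => i ik; [apply: HZ'; apply: leqW | apply: lt; apply: leqW].
- exact: subset_trans CY.
- by rewrite ZZ'; have [] := lt k (leqnn _).
exists (fun i => if (i <= k)%N then Z i else Zt); rewrite ltnn; split => //.
split => i ik; first by case: ifP => [/HZ //|_].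
have [ik'|ki] := ltnP i k; first by rewrite /= (ltnW ik'); apply: ltZ.
have -> : i = k by apply/eqP; rewrite eqn_leq -ltnS ik ki.
rewrite /= leqnn; split => // H; have [_] := lt k (leqnn _); apply.
by rewrite -ZZ' -Zk; apply: pimage_sub.
Qed.

End Lifting.

Section LinearSpaces.
Variable V : vectType K.

Definition subproj (U : {vspace V}) : set (proj V) := [set L | (val L <= U)%VS].

Lemma subproj_closed U : zclosed (subproj U).
Proof.
apply/zclosedP => L /negP/subvPn[v vL vU].
have vq : v - projv U v != 0.
  by apply: contraNneq vU => /eqP; rewrite subr_eq0 => /eqP ->; apply: memv_proj.
have [i iv] := coordlP vq.
exists 1, (fun u => (coordl i \o (\1 - projv U))%VF u); split; first exact: hform_linear.
  move=> M MU u uM; rewrite comp_lfunE add_lfunE opp_lfunE id_lfunE.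
  by rewrite projv_id ?subrr ?linear0 // (subvP MU).
move=> /(_ v vL); rewrite comp_lfunE add_lfunE opp_lfunE id_lfunE => /eqP.
by rewrite (negbTE iv).
Qed.

Lemma hform_line e (f : V -> K) (u v : V) : hform e f ->
  exists q : {poly K}, forall t, q.[t] = f (u + t *: v).
Proof.
elim=> [c|a l g _ [q Hq]|a g h _ [q Hq] _ [q' Hq']].
- by exists c%:P => t; rewrite hornerC.
- exists (((l u)%:P + l v *: 'X) * q) => t.
  rewrite hornerM hornerD hornerC hornerZ hornerX Hq linearD linearZ /=.
  by rewrite [_ *: l v]mulrC.
- by exists (q + q') => t; rewrite hornerD Hq Hq'.
Qed.

(** On the line joining a point outside A to a point outside B, the two
    separating forms restrict to nonzero polynomials, so their product does not
    vanish identically. *)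
Lemma subproj_irreducible U : U != 0%VS -> zirreducible (subproj U).
Proof.
move=> U0; split.
  have u0 : vpick U != 0 by rewrite vpick0.
  by exists (pt u0); rewrite /subproj /= -memvE memv_pick.
move=> A B cA cB sub; apply: contrapT => /not_orP[].
move=> /existsNP[L /not_implyP[LU nA]] /existsNP[M /not_implyP[MU nB]].
have [a [f [Hf fA nf]]] := (zclosedP A).1 cA L nA.
have [b [g [Hg gB ng]]] := (zclosedP B).1 cB M nB.
have [u u0 Lu] := projP L; have [v v0 Mv] := projP M.
have fu : f u != 0 by apply: nvanish Hf _ u0 nf; rewrite Lu memv_line.
have gv : g v != 0 by apply: nvanish Hg _ v0 ng; rewrite Mv memv_line.
have [q Hq] := hform_line u (v - u) Hf; have [r Hr] := hform_line u (v - u) Hg.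
have [t] : exists t, ~~ root (q * r) t.
  apply/closed_nonrootP; rewrite mulf_neq0 //.
    by apply: contraNneq fu => q0; rewrite -[u]addr0 -(scale0r (v - u)) -Hq q0 horner0.
  apply: contraNneq gv => r0; have := Hr 1; rewrite scale1r addrC subrK => <-.
  by rewrite r0 horner0.
rewrite rootM negb_or /root Hq Hr; set w := u + _ => /andP[fw gw].
have [N NU wN] : exists2 N, subproj U N & w \in val N.
  have [w0|w0] := eqVneq w 0; first by exists L => //; rewrite w0 mem0v.
  exists (pt w0); last exact: memv_line.
  have uU : u \in U by apply: (subvP LU); rewrite Lu memv_line.
  have vU : v \in U by apply: (subvP MU); rewrite Mv memv_line.
  by rewrite /subproj /= -memvE /w memvD // memvZ // memvB.
have [/fA/(_ w wN)/eqP|/gB/(_ w wN)/eqP] := sub N NU.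
  by rewrite (negbTE fw).
by rewrite (negbTE gw).
Qed.

Lemma flag_chain k : \dim {:V} = k.+1 -> exists Z : nat -> set (proj V), closed_chain k Z.
Proof.
move=> dV; have sz : size (vbasis {:V}) = k.+1 by rewrite size_tuple.
pose U i := <<take i.+1 (vbasis {:V})>>%VS.
have dU i : (i <= k)%N -> \dim (U i) = i.+1.
  move=> ik; have : free (take i.+1 (vbasis {:V})).
    by apply: (@catl_free _ _ (drop i.+1 (vbasis {:V}))); rewrite cat_take_drop (basis_free (vbasisP _)).
  by move/eqP => ->; rewrite size_takel // sz.
have UU i : (U i <= U i.+1)%VS.
  apply: sub_span => v; rewrite -[take i.+2 _](cat_take_drop i.+1).
  by rewrite mem_cat take_takel // => ->.
exists (fun i => subproj (U i)); split => i ik.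
  by split; [apply: subproj_irreducible; rewrite -dimv_eq0 dU | apply: subproj_closed].
split; first by move=> L LU; apply: subv_trans (UU i).
move=> sub; have : ~~ (U i.+1 <= U i)%VS.
  by apply/negP => /dimvS; rewrite !dU ?ltnn // ltnW.
move=> /subvPn[v vU nv]; have v0 : v != 0 by apply: contraNneq nv => ->; apply: mem0v.
have /sub : subproj (U i.+1) (pt v0) by rewrite /subproj /= -memvE.
by rewrite /subproj /= -memvE (negbTE nv).
Qed.

End LinearSpaces.
End Chains.

(** * Krull dimension and the Hilbert function *)

Section Dimension.
Variable K : closedFieldType.

(** Induction on the dimension: a form of degree e has e + 1 coefficients, each a
    form of degree at most e in one variable less. *)
Lemma hilb_le_setT k (V : vectType K) e : \dim {:V} = k.+1 -> hilb_le [set: proj V] e (e.+1 ^ k).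
Proof.
elim: k V e => [|k IH] V e dV.
all: have p0 : vpick {:V} != 0 by rewrite vpick0 -dimv_eq0 dV.
all: set p := vpick _ in p0; have [W [D dW]] := exists_point_projection p0.
- have W0 (w : W) : w = 0.
    apply/eqP; rewrite -memv0; have /eqP <- : {:W}%VS == 0%VS; last exact: memvf.
    by rewrite -dimv_eq0; move: dW; rewrite dV => -[<-].
  exists (fun _ v => hgt D v ^+ e) => f Hf; exists (fun=> f p) => v _.
  rewrite big_ord1 {1}(prj_dec D v) (W0 (prj D v)) linear0 add0r.
  by rewrite (hform_homog _ _ Hf) mulrC.
have {}dW : \dim {:W} = k.+1 by move: dW; rewrite dV => -[<-].
rewrite expnS; apply: (@hilb_le_graded _ _ _ _ D _ [set: proj W]).
- move=> v _; have [v0|v0] := eqVneq (prj D v) 0.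
    have q0 : vpick {:W} != 0 by rewrite vpick0 -dimv_eq0 dW.
    by exists (pt q0) => //; rewrite v0 mem0v.
  by exists (pt v0) => //; apply: memv_line.
- move=> f Hf; have [G [gG HG _]] := hform_expand D Hf; exists G; split => // [w|v _].
    exact: graded_size gG.
  by rewrite HG -prj_dec.
- move=> e' e'e; apply: hilb_le_mono (IH W e' dW).
  by case: (k) => // k'; rewrite leq_exp2r.
Qed.

(** The two bounds on the dimension of Y, from below by a chain and from above by
    the Hilbert function, are met by the same k. *)
Lemma closed_dimension (V : vectType K) (Y : set (proj V)) : zclosed Y -> Y !=set0 ->
  exists k c Z, [/\ closed_chain k Z, Z k `<=` Y & forall e, hilb_le Y e (c * e.+1 ^ k)].
Proof.
have [n] := ubnP (\dim {:V}); elim: n V Y => // n IH V Y ltn cY Y0.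
have [->|/eqP/setTPn[L nL]] := pselect (Y = setT).
  have [L _] := Y0.
  have [k dV] : exists k, \dim {:V} = k.+1.
    exists (\dim {:V}).-1; rewrite prednK //.
    by apply: leq_trans (dimvS (subvf (val L))); rewrite (eqP (valP L)).
  have [Z HZ] := flag_chain dV; exists k, 1%N, Z; split => // e.
  by rewrite mul1n; apply: hilb_le_setT.
have [p p0 Lp] := projP L.
have pY : ~ Y (pt p0) by rewrite (_ : pt p0 = L) //; apply/val_inj; rewrite Lp.
have [W [D dV]] := exists_point_projection p0.
pose Y' := pimage (prj D) Y.
have cY' : zclosed Y' by apply: (pimage_prj_closed D cY Y0 pY).
have Y'0 : Y' !=set0.
  by have [L' YL] := Y0; have [M ML] := prj_point D pY YL; exists M, L'.
have [|k [c [Z [HZ ZY Hc]]]] := IH W Y' _ cY' Y'0; first by move: ltn; rewrite dV.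
have [Z' [HZ' Z'Y _]] := lift_chain cY pY HZ cY (@subset_refl _ Y) ZY.
have [a Ha] := hilb_le_prj D cY Y0 pY.
exists k, (a * c)%N, Z'; split => // e; rewrite -mulnA; apply: Ha => e' e'e.
apply: hilb_le_mono (Hc e'); rewrite leq_mul2l; apply/orP; right.
by case: (k) => // k'; rewrite leq_exp2r.
Qed.

Lemma hilb_le_sub (V : vectType K) (Y Z : set (proj V)) e N : Y `<=` Z -> hilb_le Z e N -> hilb_le Y e N.
Proof.
move=> YZ [g Hg]; exists g => f /Hg[c Hc]; exists c => v [L YL vL].
by apply: Hc; exists L => //; apply: YZ.
Qed.

Lemma zchain_pdim (V : vectType K) (Y : set (proj V)) k : zchain Y k -> (k <= pdim V)%N.
Proof.
move=> HY; have gY := zchain_grows HY.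
have [L _] : Y !=set0.
  by case: gY => A _ /(_ 1%N); apply: hilb_ge_nonempty; rewrite exp1n.
have dV : \dim {:V} = (pdim V).+1.
  rewrite prednK //.
  by apply: leq_trans (dimvS (subvf (val L))); rewrite (eqP (valP L)).
apply: (grows_le (c := 1) gY) => e; rewrite mul1n.
by apply: hilb_le_sub (hilb_le_setT e dV).
Qed.

(** The length of chains is bounded by the dimension of the ambient space, so the
    maximum defining the dimension is attained. *)
Lemma zdim_ge (V : vectType K) (Y : set (proj V)) k : zchain Y k -> (k <= zdim Y)%N.
Proof.
move=> HY; suff : is_zdim Y (zdim Y) by case=> _; apply.
have [m [Hm maxm]] : exists m, is_zdim Y m.
  pose P m := `[< zchain Y m >].
  have exP : exists m, P m by exists k; apply/asboolP.
  have ubP m : P m -> (m <= pdim V)%N by move=> /asboolP; apply: zchain_pdim.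
  exists (ex_maxn exP ubP); case: ex_maxnP => m /asboolP Hm maxm.
  by split => // j /asboolP; apply: maxm.
have := @xgetPex _ 0%N [set k | is_zdim Y k]; apply.
by exists m.
Qed.

(** Positivity rules out the default value. *)
Lemma zdim_chain (V : vectType K) (Y : set (proj V)) : (0 < zdim Y)%N -> zchain Y (zdim Y).
Proof.
rewrite /zdim; case: xgetP => [k _ []//|]; by rewrite ltnn.
Qed.

Lemma zdim_le_pdim (V : vectType K) (Y : set (proj V)) : (zdim Y <= pdim V)%N.
Proof.
by have [/zdim_chain/zchain_pdim|] := ltnP 0 (zdim Y) => //; rewrite leqn0 => /eqP ->.
Qed.

Lemma zdimT (V : vectType K) : zdim [set: proj V] = pdim V.
Proof.
apply/eqP; rewrite eqn_leq zdim_le_pdim /=; have [dV|] := posnP (\dim {:V}).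
  by rewrite /pdim dV.
move=> /prednK /esym dV; have [Z HZ] := flag_chain dV.
by apply: zdim_ge; apply: closed_chain_zchain HZ _.
Qed.

(** A chain in B makes the Hilbert function of B grow, hence that of A, and for a
    closed set growth produces a chain. *)
Lemma zdim_hilb_ge (V W : vectType K) (A : set (proj V)) (B : set (proj W)) :
  zclosed A -> (forall e N, hilb_ge B e N -> hilb_ge A e N) -> (zdim B <= zdim A)%N.
Proof.
move=> cA BA; have [/zdim_chain/zchain_grows [a a0 gB]|] := ltnP 0 (zdim B); last first.
  by rewrite leqn0 => /eqP ->.
have gA : grows A (zdim B) by exists a => // t; apply/BA/gB.
have A0 : A !=set0 by case: gA => b _ /(_ 1%N); apply: hilb_ge_nonempty; rewrite exp1n.
have [k [c [Z [HZ ZA Hc]]]] := closed_dimension cA A0.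
apply: leq_trans (grows_le gA Hc) _; apply: zdim_ge.
exact: closed_chain_zchain HZ ZA.
Qed.

Lemma zdim_pimage (V W : vectType K) (phi : 'Hom(V, W)) (A : set (proj V)) (B : set (proj W)) :
  zclosed A -> B `<=` pimage phi A -> (zdim B <= zdim A)%N.
Proof. by move=> cA BA; apply: zdim_hilb_ge => // e N; apply: hilb_ge_pimage BA. Qed.

(** The linear equations of the image of phi, together with the forms of Y
    transported by a left inverse of phi, separate the image of Y. *)
Lemma pimage_injective_closed (V W : vectType K) (phi : 'Hom(V, W)) (Y : set (proj V)) :
  lker phi == 0%VS -> zclosed Y -> zclosed (pimage phi Y).
Proof.
move=> inj cY; pose psi := (phi^-1)%VF.
have psiK v : psi (phi v) = v by apply: lker0_lfunK.
apply/zclosedP => M nM; have [w w0 Mw] := projP M.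
have [Ew|Ew] := eqVneq (w - phi (psi w)) 0; last first.
  have [i iv] := coordlP Ew.
  exists 1, (fun u => (coordl i \o (\1 - (phi \o psi)))%VF u); split; first exact: hform_linear.
    move=> M' [L YL ML] u; rewrite ML => /memv_imgP[v vL ->].
    by rewrite comp_lfunE add_lfunE opp_lfunE id_lfunE comp_lfunE psiK subrr linear0.
  move=> /(_ w); rewrite Mw memv_line comp_lfunE add_lfunE opp_lfunE id_lfunE comp_lfunE => /(_ isT)/eqP.
  by rewrite (negbTE iv).
move/eqP: Ew; rewrite subr_eq0 => /eqP Ew.
have v0 : psi w != 0 by apply: contraNneq w0 => v0; rewrite Ew v0 linear0.
have nY : ~ Y (pt v0) by move=> YL; apply: nM; exists (pt v0); rewrite // Mw /= limg_line -Ew.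
have [e [f [Hf fY nf]]] := (zclosedP Y).1 cY _ nY.
exists e, (fun u => f (psi u)); split; first exact: hform_comp.
  by move=> M' [L YL ML] u; rewrite ML => /memv_imgP[v vL ->]; rewrite psiK; apply: (fY L YL).
move=> H; have fw : f (psi w) = 0 by apply: H; rewrite Mw memv_line.
by apply: nY; have := nvanish Hf (memv_line (psi w) : _ \in val (pt v0)) v0 nf; rewrite fw eqxx.
Qed.

Lemma hilb_le_pimage_injective (V W : vectType K) (phi : 'Hom(V, W)) (Y : set (proj V)) e N :
  lker phi == 0%VS -> hilb_le (pimage phi Y) e N -> hilb_le Y e N.
Proof.
move=> inj [g Hg]; exists (fun i v => g i (phi v)) => f Hf.
have [c Hc] := Hg _ (hform_comp (phi^-1)%VF Hf); exists c => v [L YL vL].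
have phi0 u : u != 0 -> phi u != 0 by rewrite -memv_ker (eqP inj) memv0.
have [w [w0 wL vw]] : exists w, [/\ w != 0, w \in val L & v \in <[w]>%VS].
  by have [w w0 Lw] := projP L; exists w; rewrite -Lw Lw memv_line -Lw.
rewrite -Hc ?lker0_lfunK //; exists (pt (phi0 w w0)).
  by exists L => //=; rewrite (projEpt w0 wL) limg_line.
by rewrite /= -limg_line memv_img.
Qed.

(** Factor phi through the projection from a point of its kernel; the kernel
    of the second factor still misses the image of Y. *)
Lemma pimage_finite (V W : vectType K) (phi : 'Hom(V, W)) (Y : set (proj V)) :
  zclosed Y -> (forall L, Y L -> exists2 v, v \in val L & phi v != 0) ->
  zclosed (pimage phi Y) /\
  exists a, forall e N, (forall e', (e' <= e)%N -> hilb_le (pimage phi Y) e' N) -> hilb_le Y e (a * N).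
Proof.
have [n] := ubnP (\dim {:V}); elim: n V phi Y => // n IH V phi Y ltn cY HY.
have [inj|ker0] := boolP (lker phi == 0%VS).
  split; first exact: pimage_injective_closed.
  by exists 1%N => e N HN; rewrite mul1n; apply: hilb_le_pimage_injective (HN e _).
have p0 : vpick (lker phi) != 0 by rewrite vpick0.
set p := vpick _ in p0; have pker : phi p = 0 by apply/eqP; rewrite -memv_ker memv_pick.
have pY : ~ Y (pt p0).
  by move=> /HY[v] /vlineP[c ->]; rewrite linearZ /= pker scaler0 eqxx.
have [W' [D dV]] := exists_point_projection p0.
have [Y0|nY] := pselect (Y !=set0); last first.
  split; last first.
    exists 0%N => e N _; rewrite mul0n; exists (fun _ _ => 0) => f _; exists (fun=> 0).
    by move=> v [L YL]; case: nY; exists L.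
  apply/zclosedP => M _; exists 0, (fun=> 1); split; first exact: hform_const.
    by move=> M' [L YL]; case: nY; exists L.
  by move=> /(_ 0 (mem0v _)) /eqP; rewrite oner_eq0.
have phiE v : phi v = (phi \o lft D)%VF (prj D v).
  by rewrite comp_lfunE {1}(prj_dec D v) linearD linearZ /= pker scaler0 addr0.
have -> : pimage phi Y = pimage (phi \o lft D)%VF (pimage (prj D) Y).
  have imE (L : proj V) : (phi @: val L = (phi \o lft D) @: (prj D @: val L))%VS.
    by rewrite -limg_comp; apply: eq_in_limg => v _; rewrite phiE [RHS]comp_lfunE.
  apply/seteqP; split => M.
    move=> [L YL ML]; have [M' M'L] := prj_point D pY YL.
    by exists M'; [exists L | rewrite M'L ML imE].
  by move=> [M' [L YL M'L] MM']; exists L => //; rewrite imE -M'L.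
have [|||cI [a Ha]] := IH W' (phi \o lft D)%VF (pimage (prj D) Y).
- by move: ltn; rewrite dV.
- exact: (pimage_prj_closed D cY Y0 pY).
- move=> M [L YL ML]; have [v vL pv] := HY L YL.
  by exists (prj D v); [rewrite ML memv_img | rewrite -phiE].
split=> //; have [b Hb] := hilb_le_prj D cY Y0 pY.
exists (b * a)%N => e N HN; rewrite -mulnA; apply: Hb => e' e'e; apply: Ha => e'' e''e'.
by apply: HN; apply: leq_trans e'e.
Qed.

(** The upper bound on the Hilbert function of the image bounds that of Y, and the
    image has a chain of the corresponding length. *)
Lemma zdim_pimage_finite (V W : vectType K) (phi : 'Hom(V, W)) (Y : set (proj V)) :
  zclosed Y -> (forall L, Y L -> exists2 v, v \in val L & phi v != 0) ->
  (zdim Y <= zdim (pimage phi Y))%N.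
Proof.
move=> cY HY; have [cI [a Ha]] := pimage_finite cY HY.
have [/zdim_chain/zchain_grows gY|] := ltnP 0 (zdim Y); last by rewrite leqn0 => /eqP ->.
have [L YL] : Y !=set0.
  by case: gY => A _ /(_ 1%N); apply: hilb_ge_nonempty; rewrite exp1n.
have I0 : pimage phi Y !=set0.
  have [v vL pv] := HY L YL; exists (pt pv), L => //=.
  have v0 : v != 0 by apply: contraNneq pv => ->; rewrite linear0.
  by rewrite (projEpt v0 vL) /= limg_line.
have [k [c [Z [HZ ZI Hc]]]] := closed_dimension cI I0.
apply: leq_trans (zdim_ge (closed_chain_zchain HZ ZI)).
apply: (grows_le (c := a * c) gY) => e; rewrite -mulnA; apply: Ha => e' e'e.
apply: hilb_le_mono (Hc e'); rewrite leq_mul2l; apply/orP; right.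
by case: (k) => // k'; rewrite leq_exp2r.
Qed.

End Dimension.

(** * The Segre variety *)

Lemma prod_sum_dffun (R : comPzSemiRingType) (I : finType) (T_ : I -> finType)
    (F : forall i, T_ i -> R) :
  \prod_i \sum_a F i a = \sum_(j : {dffun forall i, T_ i}) \prod_i F i (j i).
Proof.
pose P i := [ffun a => F i a].
transitivity (\prod_i \sum_(s in tagged_with T_ i) untag 0 (P i) s).
  apply: eq_bigr => i _; rewrite -(big_tag (fun i a => P i a)).
  by apply: eq_bigr => a _; rewrite ffunE.
rewrite bigA_distr_big_dep -big_fprod (reindex (@fprod_of_dffun I T_)); last first.
  exact/onW_bij/fprod_of_dffun_bij.
by apply: eq_bigr => j _; apply: eq_bigr => i _; rewrite ffunE fprodE.
Qed.

Section Segre.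
Variables (K : closedFieldType) (r : nat) (N : 'I_r -> nat).
Local Notation T := (segre_space K N).
Implicit Types (j : segre_index N) (u : forall i : 'I_r, 'rV[K]_(N i)).

Definition tensor u : T := [ffun j : segre_index N => \prod_(i < r) u i ord0 (j i)].

Lemma tensor_neq0 u : (forall i, u i != 0) -> tensor u != 0.
Proof.
move=> u0; have H i : exists a, u i ord0 a != 0.
  apply: contrapT => /forallNP H; case/eqP: (u0 i); apply/rowP => a; rewrite mxE.
  by apply/eqP/negPn/negP/H.
have [a Ha] : exists a : forall i, 'I_(N i), forall i, u i ord0 (a i) != 0.
  by exists (fun i => xchoose (H i)) => i; apply: (xchooseP (H i)).
apply/eqP => /ffunP/(_ (finfun a)); rewrite !ffunE => /eqP.
by rewrite prodf_seq_eq0 => /hasP[i _ /=]; rewrite ffunE (negbTE (Ha i)).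
Qed.

Lemma segreP (L : proj T) : segre K N L <->
  exists u, (forall i, u i != 0) /\ val L = <[tensor u]>%VS.
Proof. by []. Qed.

Definition entry j : 'Hom(T, K^o) := linfun (fun t : T => t j : K^o).

Lemma entryE j (t : T) : entry j t = t j.
Proof.
pose g (t : T) : K^o := t j.
have lg : linear g by move=> c v w; rewrite /g !ffunE.
pose gL := GRing.isLinear.Build K T K^o _ g lg.
pose gl : {linear T -> K^o} := HB.pack g gL.
exact: (lfunE gl).
Qed.

(** Exchanging one coordinate of two indices, as in the 2 x 2 minors of the
    flattenings of a tensor. *)
Definition swap j j' (i : 'I_r) : segre_index N := finfun (dfwith j (j' i)).

Lemma swapE j j' i k : swap j j' i k = if k == i then j' k else j k.
Proof.
rewrite ffunE; case: eqP => [->|ne]; first by rewrite dfwith_in.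
by rewrite dfwith_out //; apply/eqP => E; apply: ne.
Qed.

(** Normalise at an index j0 with nonzero entry.  The minors allow the coordinates
    of J to be replaced by those of j0 one at a time, which gives
    t J * t j0 ^ r = t j0 * prod_i t (j0 with i-th coordinate J i). *)
Lemma minors_tensor (t : T) : t != 0 ->
  (forall j j' i, t j * t j' = t (swap j j' i) * t (swap j' j i)) ->
  exists u, (forall i, u i != 0) /\ <[t]>%VS = <[tensor u]>%VS.
Proof.
move=> t0 Ht; have [j0 tj0] : exists j0, t j0 != 0.
  apply: contrapT => /forallNP H; case/eqP: t0; apply/ffunP => j; rewrite ffunE.
  by apply/eqP/negPn/negP/H.
pose mix J (s : seq 'I_r) : segre_index N := [ffun k => if k \in s then j0 k else J k].
have E J s : uniq s -> t J * t j0 ^+ size s = t (mix J s) * \prod_(i <- s) t (swap j0 J i).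
  elim: s => [_|i s IH /= /andP[nis us]].
    by rewrite big_nil expr0 !mulr1; congr (t _); apply/ffunP => k; rewrite ffunE.
  have st : t (mix J s) * t j0 = t (mix J (i :: s)) * t (swap j0 J i).
    rewrite (Ht _ j0 i); congr (t _ * t _); apply/ffunP => k.
      by rewrite swapE !ffunE inE; case: eqP.
    by rewrite !swapE !ffunE; case: eqP => // ->; rewrite (negbTE nis).
  by rewrite exprSr mulrA IH // mulrAC st big_cons mulrA.
pose u i : 'rV[K]_(N i) := \row_a (t (finfun (dfwith j0 a)) / t j0).
have tu : t = t j0 *: tensor u.
  apply/ffunP => J; rewrite !ffunE.
  have := E J _ (enum_uniq 'I_r); rewrite size_enum_ord.
  have -> : mix J (enum 'I_r) = j0 by apply/ffunP => k; rewrite ffunE mem_enum.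
  move=> EJ; have cr : t j0 ^+ r != 0 by rewrite expf_neq0.
  apply: (mulIf cr); rewrite EJ /GRing.scale /= -mulrA; congr (_ * _).
  transitivity ((\prod_(i < r) ((t (swap j0 J i) : K) / (t j0 : K)) : K) * (t j0 : K) ^+ r).
    by rewrite big_split /= prodr_const card_ord exprVn mulfVK // big_enum.
  by congr (_ * _); apply: eq_bigr => i _; rewrite mxE.
exists u; split.
  move=> i; apply/eqP => /rowP/(_ (j0 i)); rewrite !mxE => /eqP.
  have -> : finfun (dfwith j0 (j0 i)) = j0.
    by apply/ffunP => k; rewrite -[LHS]/(swap j0 j0 i k) swapE if_same.
  by rewrite divff // oner_eq0.
apply/eqP; rewrite eqEdim !dim_vline t0 -memvE {1}tu memvZ ?memv_line //=.
by rewrite leq_b1.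
Qed.

Lemma segre_closed : zclosed (segre K N).
Proof.
apply/zclosedP => L nL; have [t t0 Lt] := projP L.
have [[j [j' [i ne]]]|H] := pselect (exists j j' i, t j * t j' <> t (swap j j' i) * t (swap j' j i)).
  exists 2, (fun v => entry j v * entry j' v + -1 * (entry (swap j j' i) v * entry (swap j' j i) v)).
  have H2 a b : hform 2 (fun v => entry a v * entry b v).
    by apply: (@hform_mul _ _ 1 1); apply: hform_linear.
  split; first by apply: hform_add => //; apply: hform_scale.
    move=> M [u [u0 Mu]] v; rewrite Mu => /vlineP[c ->]; rewrite !entryE !ffunE.
    rewrite /GRing.scale /= mulN1r; apply/eqP; rewrite subr_eq0; apply/eqP.
    rewrite mulrACA [RHS]mulrACA; congr (_ * _); rewrite -!big_split /=.
    apply: eq_bigr => k _; rewrite !swapE; case: eqP => // _; exact: mulrC.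
  move=> /(_ t); rewrite Lt memv_line !entryE mulN1r => /(_ isT)/eqP.
  by rewrite subr_eq0 => /eqP.
case: nL; have [|u [u0 tu]] := minors_tensor t0.
  by move=> j j' i; apply: contrapT => ne; apply: H; exists j, j', i.
by apply/segreP; exists u; rewrite Lt.
Qed.

(** The Segre variety contains a line: two entries of the tensor, seen as a linear
    map to a plane, already take all values. *)
Lemma segre_zdim_gt0 (i0 : 'I_r) : (forall i, 0 < N i)%N -> (1 < N i0)%N ->
  (0 < zdim (segre K N))%N.
Proof.
move=> N0 N1.
pose j0 : segre_index N := [ffun i => Ordinal (N0 i)].
pose j1 : segre_index N := finfun (dfwith j0 (Ordinal N1)).
have j0E i : j0 i = 0%N :> nat by rewrite ffunE.
have j1E i : j1 i = (i == i0) :> nat.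
  rewrite ffunE; case: eqP => [->|ne]; first by rewrite dfwith_in.
  by rewrite dfwith_out ?j0E //; apply/eqP => E; apply: ne.
pose g (t : T) : 'rV[K]_2 := \row_k entry (if k == 0 then j0 else j1) t.
have lg : linear g by move=> c v w; apply/rowP => k; rewrite !mxE linearP.
pose gL := GRing.isLinear.Build K T 'rV[K]_2 _ g lg.
pose gl : {linear T -> 'rV[K]_2} := HB.pack g gL.
pose phi : 'Hom(T, 'rV[K]_2) := linfun gl.
have phiE t : phi t = \row_k (if k == 0 then t j0 else t j1).
  by rewrite (lfunE gl); apply/rowP => k; rewrite !mxE entryE; case: ifP.
have d2 : pdim 'rV[K]_2 = 1%N by rewrite /pdim dimvf.
rewrite -[X in (X < _)%N]/(0%N) -d2 -zdimT; apply: (@zdim_pimage _ _ _ phi); first exact: segre_closed.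
move=> M _; have [w w0 Mw] := projP M.
pose u i : 'rV[K]_(N i) := \row_a
  (if i == i0 then (if a == 0%N :> nat then w 0 0 else if a == 1%N :> nat then w 0 1 else 0)
   else (a == 0%N :> nat)%:R).
have u0 i : u i != 0.
  apply/eqP => /rowP E; move: w0; have := E (Ordinal (N0 i)); rewrite !mxE /=.
  case: eqP E => [->|_] E; last by move=> /eqP; rewrite oner_eq0.
  move=> w00; have := E (Ordinal N1); rewrite !mxE eqxx /= => w01.
  case/eqP; apply/rowP => k; rewrite mxE.
  by case: k => [[|[|//]] ki]; [rewrite -w00|rewrite -w01]; congr (w _ _); apply/val_inj.
have phiu : phi (tensor u) = w.
  rewrite phiE; apply/rowP => k; rewrite !mxE !ffunE.
  have -> : \prod_(i < r) u i ord0 (j0 i) = w 0 0.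
    rewrite (bigD1 i0) //= big1 ?mulr1; first by rewrite mxE eqxx j0E.
    by move=> i ne; rewrite mxE (negbTE ne) j0E.
  have -> : \prod_(i < r) u i ord0 (j1 i) = w 0 1.
    rewrite (bigD1 i0) //= big1 ?mulr1; first by rewrite mxE eqxx j1E eqxx.
    by move=> i ne; rewrite mxE (negbTE ne) j1E (negbTE ne).
  by case: k => [[|[|//]] ki] /=; congr (w _ _); apply/val_inj.
exists (pt (tensor_neq0 u0)); first by exists u.
by rewrite /= limg_line phiu.
Qed.

End Segre.

(** * Multiplication of forms *)

Section BasisCombination.
Variables (K : closedFieldType) (V : vectType K) (m : nat).
Hypothesis dV : \dim {:V} = m.

Definition comb (u : 'rV[K]_m) : V := \sum_a u ord0 a *: (vbasis {:V})`_a.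

Lemma comb_eq0 u : comb u = 0 -> u = 0.
Proof.
rewrite /comb; case: m / dV u => u E; apply/rowP => a; rewrite mxE.
exact: (freeP (basis_free (vbasisP {:V})) (fun a => u ord0 a) E a).
Qed.

Lemma comb_surj v : exists u, v = comb u.
Proof.
rewrite /comb; case: m / dV; exists (\row_a coord (vbasis {:V}) a v).
by rewrite {1}(coord_vbasis (memvf v)); apply: eq_bigr => a _; rewrite mxE.
Qed.

End BasisCombination.

Section Multiplication.
Variables (K : closedFieldType) (k d r : nat) (lam : r.-tuple nat).
Hypothesis lam_d : sumn lam = d.
Local Notation N := (fun i : 'I_r => 'C(tnth lam i + k, k)).
Local Notation T := (segre_space K N).
Local Notation S := (dhomog k.+1 K).

Lemma dim_dhomog e : \dim {: S e} = 'C(e + k, k).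
Proof. by rewrite dimvf -(bin_sub (leq_addl e k)) addnK. Qed.

Lemma prod_homog (G : 'I_r -> {mpoly K[k.+1]}) :
  (forall i, G i \is (tnth lam i).-homog) -> \prod_i G i \is d.-homog.
Proof.
move=> hG; rewrite -lam_d sumnE big_tuple.
elim: (index_enum _) => [|i s IH]; first by rewrite !big_nil dhomog1.
by rewrite !big_cons; apply: dhomogM.
Qed.

Definition basis_form (i : 'I_r) (a : nat) : S (tnth lam i) := (vbasis {: S (tnth lam i)})`_a.

Lemma basis_form_prod_homog (j : segre_index N) :
  \prod_i (basis_form i (j i) : {mpoly K[k.+1]}) \is d.-homog.
Proof. by apply: prod_homog => i; apply: dhomog_is_dhomog. Qed.

Definition mult_fun (t : T) : S d := \sum_j t j *: DHomog (basis_form_prod_homog j).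

Lemma mult_is_linear : linear mult_fun.
Proof.
move=> c s t; rewrite /mult_fun scaler_sumr -big_split /=.
by apply: eq_bigr => j _; rewrite !ffunE scalerDl scalerA.
Qed.

HB.instance Definition _ := GRing.isLinear.Build K T (S d) _ mult_fun mult_is_linear.

Definition mult : 'Hom(T, S d) := linfun mult_fun.

Definition factor (i : 'I_r) (u : 'rV[K]_(N i)) : S (tnth lam i) := comb _ u.

Lemma mult_tensor (u : forall i, 'rV[K]_(N i)) :
  (mult (tensor u) : {mpoly K[k.+1]}) = \prod_i (factor (u i) : {mpoly K[k.+1]}).
Proof.
rewrite lfunE /= /mult_fun raddf_sum /=.
under eq_bigr => j _ do rewrite ffunE.
under [RHS]eq_bigr => i _ do rewrite /factor /comb raddf_sum /=.
rewrite (prod_sum_dffun (fun i (a : 'I_(N i)) =>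
   mpoly_of_dhomog (u i ord0 a *: basis_form i a))).
apply: eq_bigr => j _ /=.
by rewrite scaler_prod.
Qed.

Lemma factor_neq0 i (u : 'rV[K]_(N i)) : u != 0 -> (factor u : {mpoly K[k.+1]}) != 0.
Proof.
apply: contraNneq => E; rewrite (comb_eq0 (dim_dhomog _) (u := u)) //.
exact: val_inj.
Qed.

Lemma mult_tensor_neq0 (u : forall i, 'rV[K]_(N i)) :
  (forall i, u i != 0) -> mult (tensor u) != 0.
Proof.
move=> u0; suff : (mult (tensor u) : {mpoly K[k.+1]}) != 0.
  by apply: contraNneq => ->; rewrite raddf0.
by rewrite mult_tensor; apply/prodf_neq0 => i _; apply: factor_neq0.
Qed.

(** Every form of degree d_i is the combination of basis elements with some
    coordinate vector, so products of forms are images of decomposable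
    tensors. *)
Lemma reducible_forms_pimage :
  reducible_forms K k d lam = pimage mult (segre_of_partition K k lam).
Proof.
apply/seteqP; split => L.
  move=> [F [G [G0 hG FG LF]]].
  have [u Hu] : exists u : forall i, 'rV[K]_(N i), forall i, G i = factor (u i).
    have H i : exists u : 'rV[K]_(N i), G i == factor u.
      have [u Hu] := comb_surj (dim_dhomog (tnth lam i)) (DHomog (hG i)).
      by exists u; rewrite /factor -Hu.
    by exists (fun i => xchoose (H i)) => i; apply/eqP/(xchooseP (H i)).
  have u0 i : u i != 0.
    by apply: contraNneq (G0 i) => ui; rewrite Hu ui /factor /comb big1 // => a _; rewrite mxE scale0r.
  exists (pt (tensor_neq0 u0)); first by exists u.
  rewrite LF /= limg_line; congr <[_]>%VS; apply: val_inj => /=.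
  by rewrite FG mult_tensor; apply: eq_bigr => i _.
move=> [M [u [u0 Mu]] LM].
exists (mult (tensor u)), (fun i => factor (u i)); split.
- by move=> i; apply: factor_neq0.
- by move=> i; apply: dhomog_is_dhomog.
- exact: mult_tensor.
- by rewrite LM Mu limg_line.
Qed.

End Multiplication.

(** * Secant varieties under linear maps *)

(** Lifts of distinct points are distinct, and the image of a sum of lines is the
    sum of the images. *)
Lemma secant_span_pimage (K : closedFieldType) (V W : vectType K) (phi : 'Hom(V, W))
    (l : nat) (X : set (proj V)) :
  secant_span l (pimage phi X) `<=` pimage phi (secant_span l X).
Proof.
move=> M [P [injP XP MP]].
have [Q HQ] : exists Q : 'I_l -> proj V, forall i, X (Q i) /\ val (P i) = (phi @: val (Q i))%VS.
  have H i : exists L, X L /\ val (P i) = (phi @: val L)%VS by have [L] := XP i; exists L.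
  by have [Q HQ] := boolp.choice H; exists Q.
have [w w0 Mw] := projP M.
have /memv_imgP[v vQ wv] : w \in (phi @: (\sum_(i < l) val (Q i)))%VS.
  rewrite limg_sum -(eq_bigr _ (fun i _ => proj2 (HQ i))).
  by apply: (subvP MP); rewrite Mw memv_line.
have v0 : v != 0 by apply: contraNneq w0 => v0; rewrite wv v0 linear0.
exists (pt v0); last by rewrite Mw /= limg_line -wv.
exists Q; split; last by rewrite /= -memvE.
  move=> i j ij; apply: injP; apply: val_inj.
  by rewrite (proj2 (HQ i)) (proj2 (HQ j)) ij.
by move=> i; have [] := HQ i.
Qed.

Lemma zdim_zclosure_secant_span (K : closedFieldType) (V W : vectType K) (phi : 'Hom(V, W))
    (l : nat) (X : set (proj V)) :
  (zdim (zclosure (secant_span l (pimage phi X))) <= zdim (zclosure (secant_span l X)))%N.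
Proof.
apply: zdim_hilb_ge; first exact: zclosure_closed.
move=> e N /hilb_ge_zclosure HB; apply: (hilb_ge_sub (@sub_zclosure _ _ _)).
exact: hilb_ge_pimage (@secant_span_pimage _ _ _ phi l X) HB.
Qed.

Local Close Scope ring_scope.
Local Close Scope classical_set_scope.

Theorem theorem8p4 (K : closedFieldType) (charK0 : [pchar K]%R =i pred0)
    (n l d r : nat) (lam : r.-tuple nat)
    (n_ge3 : 3 <= n) (l_ge2 : 2 <= l) (r_ge2 : 2 <= r)
    (lamP : is_partition d lam)
    (ndefect : ~ defective l (reducible_forms K n.-1 d lam))
    (nfill : not_overly_filling l (reducible_forms K n.-1 d lam)) :
  ~ defective l (segre_of_partition K n.-1 lam).
Proof.
have [_ lam_gt0 lam_d] := lamP.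
pose phi := mult K n.-1 lam_d; pose X := segre_of_partition K n.-1 lam.
have XX : reducible_forms K n.-1 d lam = pimage phi X by apply: reducible_forms_pimage.
move: nfill; rewrite /not_overly_filling /naive_secant_dim {ndefect}XX => nfill.
have cX : zclosed X by apply: segre_closed.
have phiX L : X L -> exists2 t, t \in val L & phi t != 0%R.
  move=> [u [u0 Lu]].
  by exists (tensor u); [rewrite Lu memv_line | apply: mult_tensor_neq0].
have leXX : zdim X <= zdim (pimage phi X) by apply: zdim_pimage_finite.
have X_gt0 : 0 < zdim X.
  apply: (@segre_zdim_gt0 _ _ _ (Ordinal (ltnW r_ge2))) => [i|].
    by rewrite bin_gt0 leq_addl.
  set e := tnth _ _; have e0 : 0 < e by apply: lam_gt0.
  case: (n) n_ge3 => [|[|m]] //= _.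
  apply: (@leq_trans 'C(m.+2, m.+1)); first by rewrite binSn.
  by apply: leq_bin2l; rewrite -add1n leq_add2r.
rewrite -/X /defective /naive_secant_dim ltn_min => /andP[lt1 lt2].
move: lt1 lt2; rewrite /secant; case: ifP => [_|_ _]; first by rewrite zdimT ltnn.
apply/negP; rewrite -leqNgt.
apply: leq_trans (zdim_zclosure_secant_span phi l X).
move: nfill; rewrite /secant; case: ifP => [big|_ ->].
  have lM : 0 < l * zdim (pimage phi X) by rewrite muln_gt0 (ltnW l_ge2) (leq_trans X_gt0).
  rewrite zdimT => E; move: big; rewrite E subn1 prednK; last first.
    by rewrite addn_gt0 (ltnW l_ge2) orbT.
  move=> big; have := leq_trans (leq_add lM (leqnn l)) big.
  by rewrite add1n ltnn.
by rewrite leq_sub2r // leq_add2r leq_mul2l leXX orbT.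
Qed.
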